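(* Let $G$ be a continuous weight matrix, let $\Omega\subset\mathbb R^n$ be a bounded $C^2$-domain, and let $u\in C^2(\overline\Omega,\mathbb R)$ be a graph of prescribed weighted mean curvature $\mathcal H\in C^0(\overline\Omega\times\mathbb R,\mathbb R)$. Assume that $u=\varphi$ on $\partial\Omega$ for some $\varphi\in C^2(\partial\Omega,\mathbb R)$ and that $|u(x)|\le M$ in $\Omega$ with some constant $M$. Let $H_G^+:\partial\Omega\to(0,+\infty)$ be the weighted mean curvature of $\partial\Omega$ with respect to the inner normal and $H_G^-:\partial\Omega\to(-\infty,0)$ the weighted mean curvature of $\partial\Omega$ with respect to the outer normal (so it is assumed that $H_G^+>0$ and $H_G^-<0$ on $\partial\Omega$), and assume that $$H_G^-(x)<\mathcal H(x,z)<H_G^+(x)\quad\text{for all }x\in\partial\Omega,\ |z|\le M .$$ Then $$\sup_{x\in\partial\Omega}|\nabla u(x)|\le C$$ with a constant $C$ depending only on the data $\Omega$, $\|\varphi\|_{C^2(\partial\Omega)}$, $M$ and the moduli of continuity of $\mathcal H$ and $G$.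
   Context: A weight matrix is a map $G=G(p)=(G_{ij}(p))_{i,j=1}^{n+1}$ from $\mathbb R^{n+1}\setminus\{0\}$ to the symmetric real $(n+1)\times(n+1)$ matrices such that (i) $\langle G(p)y,y\rangle>0$ for all $p\neq 0$ and all $y\in p^\perp\setminus\{0\}$; (ii) $t\,G(tp)=G(p)$ and $G(p)p=0$ for all $p\ne0$, $t>0$. For an immersion $X$ with unit normal $N$ put $g_{ij}=\langle\partial_iX,\partial_jX\rangle$, $b_{ij}=\langle\partial_{ij}X,N\rangle$, $S=g^{-1}b$, $A_G=(a_{ij})$ with $a_{ij}=\langle G(N)\partial_iX,\partial_jX\rangle$. The weighted mean curvature is $H_G=\mathrm{tr}(g^{-1}A_GS)$. The function $u$ is a graph of prescribed weighted mean curvature $\mathcal H$ if the immersion $X(x)=(x,u(x))$ with upper normal $N=(1+|\nabla u|^2)^{-1/2}(-\nabla u,1)$ satisfies $H_G(x)=\mathcal H(x,u(x))$ for all $x\in\Omega$. The weighted mean curvature of $\partial\Omega$ with respect to the inner (outer) normal is the weighted mean curvature of the boundary of the cylinder $\{(x,z)\in\mathbb R^{n+1}:x\in\Omega\}$ with respect to its inner (outer) normal. In terms of $d(x)=\mathrm{dist}(x,\partial\Omega)$ (which is $C^2$ on $\{x\in\overline\Omega: d(x)<\mu\}$ for small $\mu>0$), for $x\in\partial\Omega$, $$H_G^+(x)=-\sum_{i,j=1}^nG_{ij}(\nabla d(x),0)\,\partial_{ij}d(x),\qquad H_G^-(x)=\sum_{i,j=1}^nG_{ij}(-\nabla d(x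),0)\,\partial_{ij}d(x).$$
   Formalization: The constant C is also allowed to depend on the margin inf of min(H_G^+ − H, H − H_G^-) over ∂Ω × [−M,M]; without this the claimed uniformity fails (radial graphs over the unit ball with the margin tending to 0). *)

(* Defs.v *)
From HB Require Import structures.
From mathcomp Require Export all_boot all_order all_algebra.
From mathcomp Require Export all_classical all_reals all_analysis.
Export Order.TTheory GRing.Theory Num.Theory.
Export numFieldNormedType.Exports.

Set Implicit Arguments.
Unset Strict Implicit.
Unset Printing Implicit Defensive.

Local Open Scope classical_set_scope.
Local Open Scope ring_scope.

(* The norm that the library puts on 'rV_n is the maximum norm; Euclidean
   lengths and inner products are [enorm] and [dot]. *)
Definition dot (R : realType) (n : nat) (x y : 'rV[R]_n) : R :=
  \sum_(i < n) x 0 i * y 0 i.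

Definition enorm (R : realType) (n : nat) (x : 'rV[R]_n) : R :=
  Num.sqrt (dot x x).

Definition pd (R : realType) (n : nat) (W : normedModType R)
    (i : 'I_n) (f : 'rV[R]_n -> W) : 'rV[R]_n -> W :=
  fun x => 'D_(delta_mx 0 i) f x.

Definition grad (R : realType) (n : nat) (f : 'rV[R]_n -> R) (x : 'rV[R]_n) :
  'rV[R]_n := \row_i pd i f x.

(* C^k on an open set U: all partial derivatives up to order k exist and are
   continuous on U. *)
Fixpoint Ck (R : realType) (n : nat) (W : normedModType R) (k : nat)
    (U : set 'rV[R]_n) (f : 'rV[R]_n -> W) : Prop :=
  (forall x, U x -> {for x, continuous f}) /\
  (if k is k'.+1 then
     forall i : 'I_n, (forall x, U x -> derivable f x (delta_mx 0 i)) /\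
       Ck k' U (pd i f)
   else True).

Definition bdry (T : topologicalType) (A : set T) : set T :=
  closure A `\` interior A.

(* Extendability of f from Omega to a continuous function on its closure *)
Definition C0_ext (R : realType) (n : nat) (Omega : set 'rV[R]_n)
    (f : 'rV[R]_n -> R) : Prop :=
  exists g : 'rV[R]_n -> R,
    {within closure Omega, continuous g} /\ forall x, Omega x -> g x = f x.

(* C^2 up to the boundary: u is continuous on the closure, C^2 in Omega, and its
   derivatives of order 1 and 2 extend continuously to the closure.  Values of u
   outside the closure of Omega play no role. *)
Definition C2_closure (R : realType) (n : nat) (Omega : set 'rV[R]_n)
    (u : 'rV[R]_n -> R) : Prop :=
  [/\ Ck 2 Omega u,
      {within closure Omega, continuous u},
      forall i : 'I_n, C0_ext Omega (pd i u)
    & forall i j : 'I_n, C0_ext Omega (pd j (pd i u))].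

(* The gradient at a boundary point is the limit of the gradient from inside. *)
Definition bgrad (R : realType) (n : nat) (Omega : set 'rV[R]_n)
    (u : 'rV[R]_n -> R) (x : 'rV[R]_n) : 'rV[R]_n :=
  \row_i lim (pd i u y @[y --> within Omega (nbhs x)]).

Definition sup_norm (R : realType) (n : nat) (Omega : set 'rV[R]_n)
    (f : 'rV[R]_n -> R) : R := sup [set `|f x| | x in Omega].

Definition C2_norm (R : realType) (n : nat) (Omega : set 'rV[R]_n)
    (u : 'rV[R]_n -> R) : R :=
  sup_norm Omega u + \sum_(i < n) sup_norm Omega (pd i u)
  + \sum_(i < n) \sum_(j < n) sup_norm Omega (pd j (pd i u)).

(* C^2(bdry Omega) as a trace space with the quotient norm: infimum of the C^2
   norms of all extensions to the closure (Gilbarg-Trudinger, Section 6.2). *)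
Definition C2_extension (R : realType) (n : nat) (Omega : set 'rV[R]_n)
    (phi : 'rV[R]_n -> R) : set ('rV[R]_n -> R) :=
  [set Phi | C2_closure Omega Phi /\ forall x, bdry Omega x -> Phi x = phi x].

Definition C2_bdry (R : realType) (n : nat) (Omega : set 'rV[R]_n)
    (phi : 'rV[R]_n -> R) : Prop := C2_extension Omega phi !=set0.

Definition C2_norm_bdry (R : realType) (n : nat) (Omega : set 'rV[R]_n)
    (phi : 'rV[R]_n -> R) : R :=
  inf [set C2_norm Omega Phi | Phi in C2_extension Omega phi].

(* C^2 boundary in the sense of Gilbarg-Trudinger, Section 6.2: near each
   boundary point a C^2 diffeomorphism psi of an open neighborhood B, with C^2
   inverse theta, straightens the boundary.  The half space may be taken in the
   direction of any coordinate i. *)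
Definition C2_domain (R : realType) (n : nat) (Omega : set 'rV[R]_n) : Prop :=
  [/\ open Omega, connected Omega, Omega !=set0
    & forall x0, bdry Omega x0 ->
      exists (i : 'I_n) (B : set 'rV[R]_n) (psi theta : 'rV[R]_n -> 'rV[R]_n),
      [/\ open B /\ B x0,
          open (psi @` B) /\ (forall x, B x -> theta (psi x) = x),
          Ck 2 B psi /\ Ck 2 (psi @` B) theta,
          forall x, B x -> Omega x -> 0 < psi x 0 i
        & forall x, B x -> bdry Omega x -> psi x 0 i = 0]].

Definition weight_matrix (R : realType) (m : nat) (G : 'rV[R]_m -> 'M[R]_m) :
  Prop :=
  [/\ forall p, p != 0 -> (G p)^T = G p,
      forall p y, p != 0 -> y != 0 -> dot y p = 0 -> 0 < dot (y *m G p) y,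
      forall p t, p != 0 -> 0 < t -> t *: G (t *: p) = G p
    & forall p, p != 0 -> p *m G p = 0].

(* Weighted mean curvature at the parameter y of a hypersurface X : R^n -> R^m
   (m = n + 1) with respect to the unit normal N at X y.  Row vectors are
   multiplied by the symmetric matrix G N from the right. *)
Definition wmc (R : realType) (n m : nat) (G : 'rV[R]_m -> 'M[R]_m)
    (X : 'rV[R]_n -> 'rV[R]_m) (N : 'rV[R]_m) (y : 'rV[R]_n) : R :=
  let g := \matrix_(i < n, j < n) dot (pd i X y) (pd j X y) in
  let b := \matrix_(i < n, j < n) dot (pd j (pd i X) y) N in
  let A := \matrix_(i < n, j < n) dot (pd i X y *m G N) (pd j X y) in
  let S := invmx g *m b in
  \tr (invmx g *m A *m S).

Definition graph_map (R : realType) (n : nat) (u : 'rV[R]_n -> R)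
    (x : 'rV[R]_n) : 'rV[R]_(n + 1) := row_mx x (u x)%:M.

Definition upper_normal (R : realType) (n : nat) (u : 'rV[R]_n -> R)
    (x : 'rV[R]_n) : 'rV[R]_(n + 1) :=
  (Num.sqrt (1 + enorm (grad u x) ^+ 2))^-1 *: row_mx (- grad u x) 1%:M.

Definition prescribed_wmc_graph (R : realType) (n : nat)
    (G : 'rV[R]_(n + 1) -> 'M[R]_(n + 1)) (Omega : set 'rV[R]_n)
    (H : 'rV[R]_n * R -> R) (u : 'rV[R]_n -> R) : Prop :=
  forall x, Omega x -> wmc G (graph_map u) (upper_normal u x) x = H (x, u x).

Definition immersion (R : realType) (n m : nat) (U : set 'rV[R]_n)
    (X : 'rV[R]_n -> 'rV[R]_m) : Prop :=
  Ck 2 U X /\ forall y, U y -> row_free (\matrix_(i < n) pd i X y).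

Definition unit_normal (R : realType) (n m : nat) (X : 'rV[R]_n -> 'rV[R]_m)
    (y : 'rV[R]_n) (N : 'rV[R]_m) : Prop :=
  enorm N = 1 /\ forall i : 'I_n, dot (pd i X y) N = 0.

Definition points_into (R : realType) (m : nat) (A : set 'rV[R]_m)
    (p v : 'rV[R]_m) : Prop := \forall t \near 0^'+, A (p + t *: v).

Definition cylinder (R : realType) (n : nat) (Omega : set 'rV[R]_n) :
  set 'rV[R]_(n + 1) := [set p | Omega (lsubmx p)].

(* [bdry_wmc_at inner G Omega x h]: h is the weighted mean curvature, computed
   in some local parametrization X, of the boundary of the cylinder over Omega
   at a point (x, z), with respect to its inner (outer, if [inner] is false)
   normal.  For a C^2 domain h exists and does not depend on X or z. *)
Definition bdry_wmc_at (R : realType) (n : nat) (inner : bool)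
    (G : 'rV[R]_(n + 1) -> 'M[R]_(n + 1)) (Omega : set 'rV[R]_n)
    (x : 'rV[R]_n) (h : R) : Prop :=
  exists (U : set 'rV[R]_n) (X : 'rV[R]_n -> 'rV[R]_(n + 1)) (y : 'rV[R]_n)
    (z : R) (N : 'rV[R]_(n + 1)),
  [/\ open U /\ U y,
      immersion U X /\ (forall y', U y' -> bdry (cylinder Omega) (X y')),
      X y = row_mx x z%:M,
      unit_normal X y N /\
        points_into (cylinder Omega) (X y) (if inner then N else - N)
    & h = wmc G X N y].

Definition H_plus (R : realType) (n : nat)
    (G : 'rV[R]_(n + 1) -> 'M[R]_(n + 1)) (Omega : set 'rV[R]_n)
    (x : 'rV[R]_n) : R := xget 0 [set h | bdry_wmc_at true G Omega x h].

Definition H_minus (R : realType) (n : nat)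
    (G : 'rV[R]_(n + 1) -> 'M[R]_(n + 1)) (Omega : set 'rV[R]_n)
    (x : 'rV[R]_n) : R := xget 0 [set h | bdry_wmc_at false G Omega x h].

Definition modulus (R : realType) (V W : normedModType R) (A : set V)
    (f : V -> W) (t : R) : R :=
  sup [set r | exists p q, [/\ A p, A q, `|p - q| <= t & r = `|f p - f q|]].

(* By homogeneity G is determined by its values on the unit sphere. *)
Definition modulus_weight (R : realType) (m : nat) (G : 'rV[R]_m -> 'M[R]_m) :
  R -> R := modulus [set p | enorm p = 1] G.

(* Only the values of H at heights |z| <= M are relevant when |u| <= M. *)
Definition modulus_rhs (R : realType) (n : nat) (Omega : set 'rV[R]_n) (M : R)
    (H : 'rV[R]_n * R -> R) : R -> R :=
  modulus [set p : 'rV[R]_n * R | closure Omega p.1 /\ `|p.2| <= M] H.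

(* The margin in the strict inequalities H_minus < H < H_plus.  Moduli of
   continuity do not bound it from below, and the gradient estimate degenerates
   as it tends to 0. *)
Definition curvature_gap (R : realType) (n : nat)
    (G : 'rV[R]_(n + 1) -> 'M[R]_(n + 1)) (Omega : set 'rV[R]_n) (M : R)
    (H : 'rV[R]_n * R -> R) : R :=
  inf [set r | exists x z, [/\ bdry Omega x, `|z| <= M
    & r = Num.min (H_plus G Omega x - H (x, z)) (H (x, z) - H_minus G Omega x)]].

(* Main.v *)
From HB Require Import structures.
Require Import Defs.
From mathcomp Require Import ring lra.

(** The upper barrier at a boundary point [x0] is [Phi + L rho + kappa |x - x0|^2],
    where [Phi] extends [phi] and [rho] is a local C^2 function defining [Omega];
    the lower barrier has the opposite signs.  [kappa] makes the barrier exceed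
    [|u|] away from [x0].  As [G] is homogeneous of degree [-1], the factor [L]
    cancels in [tr (G(-grad w, 1) D^2 w)], which therefore tends, as [L] grows, to
    [tr (G(-grad rho, 0) D^2 rho)], the value of [H_minus] on the boundary
    ([- H_plus] for the lower barrier).  The gap between these and [H] makes the
    barrier a strict supersolution for large [L], uniformly over all [G] and [H]
    with given moduli, so [u] minus the barrier has no interior maximum.  A linear
    term in [rho] suffices because the inequalities are strict, and any defining
    function can replace the distance function because of the homogeneity.
    Compactness of the boundary makes [L] uniform in [x0]. *)

Set Implicit Arguments.
Unset Strict Implicit.
Unset Printing Implicit Defensive.

Local Open Scope classical_set_scope.
Local Open Scope ring_scope.

(** * Linear algebra *)

Section psd.
Variable R : realFieldType.

(** The operator [tr (G(-grad w, 1) D^2 w)] is quasilinear, yet it is never linearized. At an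
    interior maximum of [u] minus the barrier the two functions have the same gradient, hence the
    same positive semidefinite coefficient matrix, and only their Hessians remain to be compared.

    The barriers bound [|u - Phi|] by a function that vanishes at [x0], but points of [Omega] can be
    reached from [x0] only along directions that enter [Omega]. Derivatives are therefore bounded
    along such directions first; every coordinate direction is a difference of two of them, which
    yields the full gradient.

    Uniformity rests on the order of choices: radii, [kappa] and [L] are fixed from the moduli and
    the gap before [G], [H], [phi] and [u] appear. The modulus of [G] on the sphere even bounds its
    size, because [G q] annihilates [q].

    [H_plus] and [H_minus] are values picked out of the curvatures in all parametrizations. A
    defining function shows that these agree, and it turns them into an expression whose continuity
    can be checked. *)

Definition form n (A : 'M[R]_n) (y z : 'rV[R]_n) : R := (y *m A *m z^T) 0 0.

Lemma formDl n (A : 'M[R]_n) x y z : form A (x + y) z = form A x z + form A y z.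
Proof. by rewrite /form !mulmxDl mxE. Qed.

Lemma formZl n (A : 'M[R]_n) c x z : form A (c *: x) z = c * form A x z.
Proof. by rewrite /form -!scalemxAl mxE. Qed.

Lemma formDr n (A : 'M[R]_n) x y z : form A x (y + z) = form A x y + form A x z.
Proof. by rewrite /form linearD /= mulmxDr mxE. Qed.

Lemma formZr n (A : 'M[R]_n) c x z : form A x (c *: z) = c * form A x z.
Proof. by rewrite /form linearZ /= -scalemxAr mxE. Qed.

Lemma form_sym n (A : 'M[R]_n) x y : A^T = A -> form A x y = form A y x.
Proof.
move=> sA; rewrite /form -[x *m A *m y^T]trmxK mxE.
by rewrite !trmx_mul trmxK sA mulmxA.
Qed.

Lemma form_delta n (A : 'M[R]_n) i j :
  form A (delta_mx 0 i) (delta_mx 0 j) = A i j.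
Proof. by rewrite /form -rowE trmx_delta -colE !mxE. Qed.

Lemma psd_diag0 n (A : 'M[R]_n) i j : A^T = A -> (forall y, 0 <= form A y y) ->
  A i i = 0 -> A i j = 0.
Proof.
move=> sA pA Aii; apply/eqP; apply: contraT => Aij.
have sAij : A j i = A i j by rewrite -[in LHS]sA mxE.
(* The coefficient is chosen so that the quadratic form takes the value -1 at this vector. *)
have := pA (delta_mx 0 j - ((A j j + 1) / (2 * A i j)) *: delta_mx 0 i).
rewrite -scaleNr !(formDl, formDr, formZl, formZr) !form_delta Aii sAij.
rewrite ?(mulr0, addr0, mulNr).
have -> : (A j j + 1) / (2 * A i j) * A i j = (A j j + 1) / 2.
  by field.
lra.
Qed.

(* By elimination: [A] minus a rank one piece built from its row [k] is still
   positive semidefinite and has one more zero on the diagonal. *)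
Lemma mxtrace_psd_nsd n (A D : 'M[R]_n) : A^T = A ->
  (forall y, 0 <= form A y y) -> (forall y, form D y y <= 0) ->
  \tr (A *m D) <= 0.
Proof.
move=> + + nD; have [m] := ubnP #|[set i | A i i != 0]%SET|.
elim: m A => // m IH A ltm sA pA.
have [k Akk|A0] := pickP (fun k => A k k != 0); last first.
  suff -> : A = 0 by rewrite mul0mx mxtrace0.
  apply/matrixP => i j; rewrite mxE; apply: psd_diag0 => //.
  by have := A0 i; rewrite /= => /negbFE/eqP.
have Akk0 : 0 < A k k.
  by rewrite lt_neqAle eq_sym Akk -form_delta pA.
pose r := row k A; pose A' := A - (A k k)^-1 *: (r^T *m r).
have sA' : A'^T = A'.
  by rewrite /A' linearB linearZ /= trmx_mul trmxK sA.
have fA' y : form A' y y = form A y y - (A k k)^-1 * (form A y (delta_mx 0 k)) ^+ 2.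
  rewrite /form /A' mulmxBr mulmxBl mxE [X in _ + X]mxE; congr (_ - _).
  rewrite -scalemxAr -scalemxAl mxE; congr (_ * _).
  rewrite mulmxA -(mulmxA (y *m r^T)) mxE big_ord1 expr2.
  rewrite /r rowE trmx_mul sA mulmxA; congr (_ * _).
  rewrite -[LHS]/(form A (delta_mx 0 k) y).
  by rewrite form_sym.
have pA' y : 0 <= form A' y y.
  (* [form A' y y] is the value of [form A] at [y] with its [A]-orthogonal component along the
     [k]-th basis vector removed. *)
  have := pA (y - (form A y (delta_mx 0 k) / A k k) *: delta_mx 0 k).
  rewrite -scaleNr !(formDl, formDr, formZl, formZr) !form_delta fA'.
  rewrite [form A (delta_mx 0 k) y]form_sym //.
  move=> /le_trans; apply; rewrite le_eqVlt; apply/orP; left; apply/eqP.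
  by field.
have -> : A = A' + (A k k)^-1 *: (r^T *m r) by rewrite /A' subrK.
rewrite mulmxDl mxtraceD -scalemxAl mxtraceZ.
have -> : \tr (r^T *m r *m D) = form D r r.
  by rewrite -mulmxA mxtrace_mulC /mxtrace big_ord1.
have : \tr (A' *m D) <= 0.
  apply: IH => //; rewrite -ltnS (leq_trans _ ltm) // ltnS.
  apply: proper_card; apply/properP; split.
    apply/fintype.subsetP => i; rewrite !inE; apply: contra => /eqP Aii.
    rewrite /A' !mxE big_ord1 !mxE Aii sub0r.
    rewrite -[in A k i]sA mxE (@psd_diag0 _ A i k) //.
    by rewrite mulr0 mulr0 oppr0.
  exists k; rewrite !inE // negbK /A' !mxE big_ord1 !mxE.
  by rewrite mulrA mulVf // mul1r subrr.
have : (A k k)^-1 * form D r r <= 0.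
  by rewrite mulr_ge0_le0 ?invr_ge0 // ltW.
lra.
Qed.

Lemma mulmx_tr_eq0 m n (E : 'M[R]_(m, n)) (x : 'rV[R]_m) :
  x *m (E *m E^T) = 0 -> x *m E = 0.
Proof.
move=> x0; have /matrixP/(_ 0 0) : (x *m E) *m (x *m E)^T = 0.
  by rewrite trmx_mul mulmxA -(mulmxA x) x0 mul0mx.
rewrite !mxE => /eqP; rewrite psumr_eq0; last first.
  by move=> i _; rewrite [_^T _ _]mxE -expr2 sqr_ge0.
move=> /allP s0; apply/rowP => j; rewrite [RHS]mxE.
have := s0 j; rewrite mem_index_enum => /(_ isT) /=.
by rewrite [_^T _ _]mxE -expr2 sqrf_eq0 => /eqP.
Qed.

Lemma gram_unitmx m n (E : 'M[R]_(m, n)) : row_free E -> E *m E^T \in unitmx.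
Proof.
move=> fE; rewrite -row_free_unit -kermx_eq0; apply/rowV0P => x /sub_kermxP.
by move=> /mulmx_tr_eq0 x0; apply: (row_free_inj fE); rewrite x0 mul0mx.
Qed.

(* [E^T *m invmx (E *m E^T) *m E] is the orthogonal projection along [N], which
   fixes [G]. *)
Lemma mxtrace_tangent n (E : 'M[R]_(n, n + 1)) (N : 'rV[R]_(n + 1)) G D :
  row_free E -> N != 0 -> E *m N^T = 0 -> G^T = G -> N *m G = 0 ->
  \tr (invmx (E *m E^T) *m (E *m G *m E^T) *m
       (invmx (E *m E^T) *m (E *m D *m E^T))) = \tr (G *m D).
Proof.
move=> fE N0 EN sG NG; have gU := gram_unitmx fE.
set g := E *m E^T in gU *.
have rkN : \rank (kermx N^T) = n.
  by rewrite mxrank_ker mxrank_tr rank_rV N0 addnK.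
have GN : G *m N^T = 0 by rewrite -sG -trmx_mul NG trmx0.
(* By a dimension count the rows of [E] span the orthogonal complement of [N], and the rows of [G]
   lie there. *)
have GE : (G <= E)%MS.
  have EK : (E <= kermx N^T)%MS by apply/sub_kermxP.
  have GK : (G <= kermx N^T)%MS by exact/sub_kermxP.
  apply: submx_trans GK _.
  by rewrite -(geq_leqif (mxrank_leqif_sup EK)) rkN (eqP fE).
have [C GC] := submxP GE.
have PG : G *m (E^T *m invmx g *m E) = G.
  by rewrite GC -!mulmxA (mulmxA E E^T) (mulmxA (E *m E^T)) mulmxV // mul1mx.
have PG' : (E^T *m invmx g *m E) *m G = G.
  have gT : (invmx g)^T = invmx g by rewrite trmx_inv /g trmx_mul trmxK.
  by have := congr1 trmx PG; rewrite !trmx_mul trmxK gT sG !mulmxA.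
rewrite -[in RHS]PG -[in RHS]PG' mulmxA.
rewrite -!mulmxA mxtrace_mulC -!mulmxA.
by rewrite [RHS]mxtrace_mulC -!mulmxA [RHS]mxtrace_mulC -!mulmxA.
Qed.

End psd.

(** * Differential calculus on row vectors *)

Section calculus.
Variable R : realType.

Lemma ler_mxe m n (A : 'M[R]_(m, n)) i j : `|A i j| <= `|A|.
Proof.
rewrite [leRHS]/Num.norm /= mx_normrE.
exact: (le_bigmax _ (fun ij : 'I_m * 'I_n => `|A ij.1 ij.2|) (i, j)).
Qed.

Lemma mx_norm_le m n (A : 'M[R]_(m, n)) e : 0 <= e ->
  (forall i j, `|A i j| <= e) -> `|A| <= e.
Proof.
by move=> e0 Ae; rewrite [leLHS]/Num.norm /= mx_normrE bigmax_le // => -[].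
Qed.

Lemma is_derive_line (V W : normedModType R) (f : V -> W) (a v : V) (t : R) :
  derivable f (a + t *: v) v ->
  is_derive t (1 : R) (fun s : R => f (a + s *: v)) ('D_v f (a + t *: v)).
Proof.
have E : (fun h => h^-1 *: (f (a + (h *: (1 : R) + t) *: v) - f (a + t *: v)))
       = (fun h => h^-1 *: (f (h *: v + (a + t *: v)) - f (a + t *: v))).
  by apply/funext => h; rewrite [_ *: 1]mulr1 scalerDl addrCA.
by move=> fv; apply: DeriveDef; rewrite /derivable /derive /= E.
Qed.

Lemma dot_is_linear n (w : 'rV[R]_n) : linear (fun v => dot v w : R^o).
Proof.
move=> c x y; rewrite /dot scaler_sumr -big_split /=; apply: eq_bigr => i _.
by rewrite !mxE mulrDl /GRing.scale /= mulrA.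
Qed.
(** Only a partial derivative is assumed, so the chain rule is applied to [f] restricted to the
    axis, where derivability and differentiability agree. *)
Lemma derive_axis (W : normedModType R) n (f : 'rV[R]_n -> W) (a : 'rV[R]_n)
    (i : 'I_n) (c s : R) :
  derivable f (a + s *: (c *: delta_mx 0 i)) (delta_mx 0 i) ->
  is_derive s (1 : R) (fun s : R => f (a + s *: (c *: delta_mx 0 i)))
    (c *: pd i f (a + s *: (c *: delta_mx 0 i))).
Proof.
have E : a + s *: (c *: delta_mx 0 i) = a + (s * c) *: delta_mx 0 i.
  by rewrite scalerA.
rewrite E => /is_derive_line/=; rewrite -/(pd i f _) => fd.
have -> : (fun s : R => f (a + s *: (c *: delta_mx 0 i)))
    = (fun s : R => f (a + s *: delta_mx 0 i)) \o (fun s : R => s * c).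
  by apply/funext => t /=; rewrite scalerA.
have dc : is_derive s (1:R) (fun s : R => s * c) c.
  have -> : (fun s : R => s * c) = c \*: id.
    by apply/funext => t /=; rewrite mulrC.
  by apply: is_derive_eq; rewrite [LHS]mulr1.
have h1 : differentiable (fun s : R => s * c) s.
  by apply/derivable1_diffP; exact: ex_derive.
have h2 : differentiable (fun s : R => f (a + s *: delta_mx 0 i)) (s * c).
  by apply/derivable1_diffP; exact: ex_derive.
have h3 := differentiable_comp h1 h2.
apply: DeriveDef; first exact/derivable1_diffP.
rewrite deriveE // diff_comp //= -!deriveE // derive_val.
rewrite deriveE // -[X in 'd _ _ X]mulr1 -[X in 'd _ _ X]/(c *: (1:R)).
by rewrite linearZ /= -deriveE // derive_val.
Qed.

(** The increment telescopes along the path from [a] to [a + h] that adds one coordinate of [h] at a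
    time, so partial derivatives suffice. In the maximum norm the whole path stays within [|h|] of
    [a]. *)
Lemma C1_expansion n (f : 'rV[R]_n -> R) (a : 'rV[R]_n) (r e : R) :
  0 <= e ->
  (forall (y : 'rV[R]_n) i, `|a - y| < r -> derivable f y (delta_mx 0 i)) ->
  (forall (y : 'rV[R]_n) i, `|a - y| < r -> `|pd i f y - pd i f a| <= e) ->
  forall h, `|h| < r ->
    `|f (a + h) - f a - dot h (grad f a)| <= n%:R * e * `|h|.
Proof.
move=> e0 df cf h hr.
pose hk k : 'rV[R]_n := \row_j (if (j < k)%N then h 0 j else 0).
have hn : hk n = h by apply/rowP => j; rewrite mxE ltn_ord.
have h0 : hk 0%N = 0 by apply/rowP => j; rewrite !mxE ltn0.
have step (k : 'I_n) :
    `|f (a + hk k.+1) - f (a + hk k) - h 0 k * pd k f a| <= e * `|h|.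
  have hkS : hk k.+1 = hk k + 1 *: (h 0 k *: delta_mx 0 k).
    apply/rowP => j; rewrite !mxE eqxx /= mul1r ltnS leq_eqVlt.
    have [->|jk] := eqVneq j k; first by rewrite eqxx ltnn mulr1 add0r.
    by rewrite (negbTE (jk : (j : nat) != k)) /= mulr0 addr0.
  have near (s : R) : 0 <= s <= 1 ->
      `|a - (a + hk k + s *: (h 0 k *: delta_mx 0 k))| < r.
    move=> /andP[s0 s1]; apply: le_lt_trans hr.
    rewrite -addrA opprD addrA subrr add0r normrN; apply: mx_norm_le => // i j.
    rewrite !mxE ord1 eqxx /=; have [->|jk] := eqVneq j k.
      rewrite ltnn add0r mulr1 normrM ger0_norm //.
      by apply: le_trans (ler_mxe h 0 k); rewrite ler_piMl.
    rewrite mulr0 mulr0 addr0; case: ifP => _; last by rewrite normr0.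
    exact: ler_mxe.
  pose F (s : R) := f (a + hk k + s *: (h 0 k *: delta_mx 0 k)).
  pose F' (s : R) := h 0 k *: pd k f (a + hk k + s *: (h 0 k *: delta_mx 0 k)).
  have dF (s : R) : 0 <= s <= 1 -> is_derive s (1 : R) F (F' s).
    by move=> s01; apply: derive_axis; apply: df; exact: near.
  have [| |c cab cE] := @MVT R F F' 0 1 ltr01.
  - by move=> s; rewrite in_itv /= => /andP[/ltW s0 /ltW s1]; apply: dF; rewrite s0.
  - apply: derivable_within_continuous => s; rewrite in_itv /= => s01.
    by have := dF _ s01.
  move: cE; rewrite hkS addrA /F scale0r addr0 subr0 mulr1 => ->; rewrite /F'.
  rewrite -mulrBr normrM mulrC ler_pM // ?ler_mxe //.
  by apply: cf; apply: near; move: cab; rewrite in_itv /= => /andP[/ltW-> /ltW->].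
have -> : f (a + h) - f a - dot h (grad f a) =
    \sum_(k < n) (f (a + hk k.+1) - f (a + hk k) - h 0 k * pd k f a).
  rewrite sumrB; congr (_ - _); last by apply: eq_bigr => i _; rewrite mxE.
  rewrite -(big_mkord xpredT (fun k => f (a + hk k.+1) - f (a + hk k))).
  by rewrite telescope_sumr // hn h0 addr0.
apply: (le_trans (ler_norm_sum _ _ _)).
apply: (@le_trans _ _ (\sum_(k < n) e * `|h|)); first exact: ler_sum.
by rewrite sumr_const card_ord -mulrA mulr_natl.
Qed.

Lemma cvg_sum_ord (T : Type) (F : set_system T) {FF : Filter F} n
    (f : 'I_n -> T -> R) (l : 'I_n -> R) :
  (forall i, f i x @[x --> F] --> l i) ->
  (\sum_(i < n) f i x) @[x --> F] --> \sum_(i < n) l i.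
Proof.
elim: n f l => [|n IH] f l fl.
  by rewrite big_ord0; under eq_cvg do rewrite big_ord0; exact: cvg_cst.
rewrite big_ord_recl; under eq_cvg do rewrite big_ord_recl.
by apply: cvgD; [exact: fl|apply: IH => i; exact: fl].
Qed.

Lemma dot_continuous n (w : 'rV[R]_n) : continuous (fun v => dot v w : R).
Proof.
move=> v.
apply: (@cvg_sum_ord _ (nbhs v) _ n (fun i (x : 'rV[R]_n) => x 0 i * w 0 i)
  (fun i => v 0 i * w 0 i)) => i.
apply: cvgMr_tmp; exact: coord_continuous.
Qed.

Lemma C1_differentiable n (U : set 'rV[R]_n) (f : 'rV[R]_n -> R) a :
  open U -> Ck 1 U f -> U a ->
  differentiable f a /\ 'd f a = (fun v => dot v (grad f a)) :> ('rV[R]_n -> R).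
Proof.
move=> oU [_ fU] Ua.
pose dfM := GRing.isLinear.Build R 'rV[R]_n R _ _ (dot_is_linear (grad f a)).
pose df : {linear 'rV[R]_n -> R} := HB.pack (fun v => dot v (grad f a) : R) dfM.
have dfc : continuous df by exact: dot_continuous.
(* The premise of [diff_unique], extracted as [fo], says that the remainder after the linear part
   [df] is little-o. *)
have dU := @diff_unique R 'rV[R]_n R f df a dfc.
match type of dU with ?P -> _ => have fo : P end.

  apply/eqaddoP => e e0.
  (* Dividing by [n.+1] rather than [n] keeps the divisor positive; the [n] error terms still add up
     to at most [e]. *)
  have /nbhs_normP[r /= r0 rU] : nbhs a (U `&`
      [set y | forall i, `|pd i f y - pd i f a| <= e / n.+1%:R]).
    apply: filterI; first exact: open_nbhs_nbhs.
    suff : \forall y \near a, forall i, `|pd i f y - pd i f a| <= e / n.+1%:R by [].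
    apply: (@filter_forall _ _ (fun i y => `|pd i f y - pd i f a| <= e / n.+1%:R)
      (nbhs a) (nbhs_filter a)) => i; have [_ [/(_ a Ua) + _]] := fU i.
    move/cvgrPdist_le => /(_ (e / n.+1%:R)); rewrite divr_gt0 // => /(_ isT).
    by apply: filterS => y; rewrite distrC.
  near=> h; rewrite /= !fctE /= [h + a]addrC opprD addrA.
  apply: le_trans (C1_expansion (e := e / n.+1%:R) (r := r) _ _ _ _) _.
  - by rewrite divr_ge0 // ltW.
  - by move=> y i yr; have [/(_ y)h1 _] := fU i; apply: h1; have [] := rU y yr.
  - by move=> y i yr; have [_] := rU y yr; exact.
  - near: h; have : \forall x \near (0 : 'rV[R]_n), `|x| < r.
      by apply/nbhs_norm0P; exists r.
    exact.
  apply: ler_wpM2r => //.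
  rewrite mulrCA ler_piMr ?(ltW e0) // ler_pdivrMr // mul1r ler_nat.
  by [].
have dE := diff_unique dfc fo; split => //.
by apply/diff_locallyP; rewrite dE.
Unshelve. all: by end_near. Qed.

End calculus.

(** * Second order calculus along lines *)

Section calculus2.
Variable R : realType.

Definition hess n (f : 'rV[R]_n -> R) (x : 'rV[R]_n) : 'M[R]_n :=
  \matrix_(i, j) pd j (pd i f) x.

Lemma is_derive_sum_ord (V : normedModType R) n (h dh : 'I_n -> V -> R) (x v : V) :
  (forall i, is_derive x v (h i) (dh i x)) ->
  is_derive x v (fun y => \sum_(i < n) h i y) (\sum_(i < n) dh i x).
Proof.
move=> hd; have -> : (fun y => \sum_(i < n) h i y) = \sum_(i < n) h i.
  by apply/funext => y; rewrite fct_sumE.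
exact: is_derive_sum.
Qed.

Lemma is_derive_from_line (V W : normedModType R) (f : V -> W) (a v : V) (d : W) :
  is_derive (0 : R) (1 : R) (fun s : R => f (a + s *: v)) d -> is_derive a v f d.
Proof.
have E : (fun h : R => h^-1 *: (f (a + (h *: (1 : R) + 0) *: v) - f (a + 0 *: v)))
       = (fun h => h^-1 *: (f (h *: v + a) - f a)).
  by apply/funext => h; rewrite addr0 [_ *: 1]mulr1 scale0r addr0 [a + h *: v]addrC.
move=> [fd fE]; apply: DeriveDef.
  by move: fd; rewrite /derivable E.
by move: fE; rewrite /derive E.
Qed.

Lemma is_derive_coord (V : normedModType R) m n (M : V -> 'M[R]_(m, n)) t v i j :
  derivable M t v -> is_derive t v (fun x => M x i j) (('D_v M t) i j).
Proof.
move=> dM; rewrite derive_mx // mxE; apply: derivableP.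
by move/derivable_mxP : dM.
Qed.

(** [g] is derivable only in the direction [v], so the composition is differentiated on the line
    [a + s *: v], where this amounts to differentiability. *)
Lemma C1_chain (V : normedModType R) n (B : set 'rV[R]_n) (f : 'rV[R]_n -> R)
    (g : V -> 'rV[R]_n) (a v : V) :
  open B -> Ck 1 B f -> B (g a) -> derivable g a v ->
  is_derive a v (f \o g) (dot ('D_v g a) (grad f (g a))).
Proof.
move=> oB fB Bga dg; apply: is_derive_from_line.
have E : a + (0 : R) *: v = a by rewrite scale0r addr0.
have dc : is_derive (0 : R) (1 : R) (fun s : R => g (a + s *: v)) ('D_v g a).
  by have h := @is_derive_line R V _ g a v 0; rewrite E in h; exact: (h dg).
have dc1 : differentiable (fun s : R => g (a + s *: v)) (0 : R).
  by apply/derivable1_diffP; exact: ex_derive.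
have [fd fE] := C1_differentiable oB fB Bga.
have fd' : differentiable f ((fun s : R => g (a + s *: v)) 0) by rewrite E.
apply: DeriveDef.
  apply/derivable1_diffP; exact: (differentiable_comp dc1 fd').
rewrite deriveE; last exact: (differentiable_comp dc1 fd').
rewrite (diff_comp dc1 fd') /= -[X in 'd f _ X]deriveE // derive_val E.
by rewrite fE.
Qed.

Lemma C1_line n (U : set 'rV[R]_n) (f : 'rV[R]_n -> R) (a y : 'rV[R]_n) (t : R) :
  open U -> Ck 1 U f -> U (a + t *: y) ->
  is_derive t (1 : R) (fun s : R => f (a + s *: y)) (dot y (grad f (a + t *: y))).
Proof.
move=> oU fU Ut; have [fd fE] := C1_differentiable oU fU Ut.
rewrite -[dot _ _]/((fun v => dot v (grad f (a + t *: y))) y) -fE -deriveE //.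
by apply: is_derive_line; exact: diff_derivable.
Qed.

Lemma formE n (A : 'M[R]_n) y z :
  form A y z = \sum_i y 0 i * \sum_j z 0 j * A i j.
Proof.
rewrite /form mxE; under eq_bigr do rewrite !mxE mulr_suml.
rewrite exchange_big; apply: eq_bigr => i _; rewrite mulr_sumr.
by apply: eq_bigr => j _; ring.
Qed.

Lemma C2_C1pd n (U : set 'rV[R]_n) (f : 'rV[R]_n -> R) i :
  Ck 2 U f -> Ck 1 U (pd i f).
Proof. by move=> [_ /(_ i)[]]. Qed.

Lemma C2_C1 (W : normedModType R) n (U : set 'rV[R]_n) (f : 'rV[R]_n -> W) :
  Ck 2 U f -> Ck 1 U f.
Proof.
by move=> [cf fU]; split => // i; have [h1 [h2 _]] := fU i.
Qed.

Lemma C2_line n (U : set 'rV[R]_n) (f : 'rV[R]_n -> R) (a y : 'rV[R]_n) :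
  open U -> Ck 2 U f -> U a ->
  is_derive (0 : R) (1 : R) (fun s : R => dot y (grad f (a + s *: y)))
    (form (hess f a) y y).
Proof.
move=> oU fU Ua.
have E : a + (0 : R) *: y = a by rewrite scale0r addr0.
have -> : (fun s : R => dot y (grad f (a + s *: y)))
    = (fun s : R => \sum_i y 0 i * pd i f (a + s *: y)).
  by apply/funext => s; apply: eq_bigr => i _; rewrite mxE.
rewrite formE.
apply: (@is_derive_sum_ord _ _ _ 
  (fun i _ => y 0 i * \sum_j y 0 j * hess f a i j)) => i.
have := @C1_line n U (pd i f) a y 0 oU (C2_C1pd i fU); rewrite E => /(_ Ua) d.
rewrite (_ : \sum_j _ = dot y (grad (pd i f) a)); last first.
  by apply: eq_bigr => j _; rewrite !mxE.
have := @is_deriveZ R R R (fun s => pd i f (a + s *: y)) (y 0 i) 0 1 _ d.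
exact.
Qed.

(** If [d] were positive, [f'] would be positive just to the right of 0, and the mean value theorem
    would give [f t > f 0] there. *)
Lemma second_derivative_max (f f' : R -> R) (d e : R) : 0 < e ->
  (forall t, `|t| < e -> is_derive t (1 : R) f (f' t)) ->
  is_derive (0 : R) (1 : R) f' d ->
  (forall t, `|t| < e -> f t <= f 0) -> f' 0 = 0 /\ d <= 0.
Proof.
move=> e0 df df' fmax.
have f'0 : f' 0 = 0.
  have := @derive1_at_max R f (- e) e 0.
  have ee : - e <= e by lra.
  case.
  - by [].
  - move=> t; rewrite in_itv /= => te.
    have tn : `|t| < e by rewrite ltr_norml.
    by have := df t tn.
  - by rewrite in_itv /= oppr_lt0 e0.
  - move=> t; rewrite in_itv /= => te; apply: fmax.
    by rewrite ltr_norml.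
  have f0 := df 0; rewrite normr0 in f0; have := f0 e0.
  by move=> [_ fE] _ f0E; rewrite -fE.
split => //; rewrite leNgt; apply/negP => d0.
have [r /= r0 rP] : \forall h \near (0:R)^', 0 < h^-1 * (f' (h + 0) - f' 0).
  have [dd dE] := df'.
  have /cvgrPdist_lt /(_ d d0) : h^-1 * (f' (h * 1 + 0) - f' 0) @[h --> (0:R)^'] --> d.
    by move: dd; rewrite /derivable -dE.
  apply: filterS => h; rewrite mulr1 ltr_distlC; lra.
pose t := Num.min (r / 2) (e / 2).
have t0 : 0 < t by rewrite lt_min !divr_gt0.
have tr : t < r.
  have : t <= r / 2 by rewrite ge_min lexx.
  by have := r0; lra.
have te : t < e.
  have : t <= e / 2 by rewrite ge_min lexx orbT.
  by have := e0; lra.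
have dft s : 0 <= s <= t -> is_derive s (1 : R) f (f' s).
  move=> /andP[s0 st]; apply: df; rewrite ger0_norm //; exact: le_lt_trans st te.
have [| |c] := @MVT R f f' 0 t t0.
- by move=> s; rewrite in_itv /= => /andP[/ltW s0 /ltW s1]; apply: dft; rewrite s0.
- apply: derivable_within_continuous => s; rewrite in_itv /= => s01.
  by have := dft _ s01.
rewrite in_itv /= => /andP[c0 ct] fE.
have := rP c; rewrite /ball_ /= sub0r normrN gtr0_norm // => /(_ (lt_trans ct tr)).
move=> /(_ (lt0r_neq0 c0)); rewrite addr0 f'0 subr0 pmulr_rgt0 ?invr_gt0 // => c1.
have : f t <= f 0 by apply: fmax; rewrite gtr0_norm.
have : 0 < f' c * (t - 0) by rewrite subr0 mulr_gt0.
by rewrite -fE; lra.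
Qed.

End calculus2.

(** * Weight matrices and graphs *)

Section weight.
Variable R : realType.

Lemma form_dot n (A : 'M[R]_n) y z : form A y z = dot (y *m A) z.
Proof. by rewrite /form mxE; apply: eq_bigr => i _; rewrite [z^T _ _]mxE. Qed.

Lemma dotC n (x y : 'rV[R]_n) : dot x y = dot y x.
Proof. by apply: eq_bigr => i _; rewrite mulrC. Qed.

Lemma dotE n (x y : 'rV[R]_n) : dot x y = (x *m y^T) 0 0.
Proof. by rewrite mxE; apply: eq_bigr => i _; rewrite mxE. Qed.

Lemma dotDl n (x y z : 'rV[R]_n) : dot (x + y) z = dot x z + dot y z.
Proof. by rewrite !dotE mulmxDl mxE. Qed.

Lemma dotZl n c (x z : 'rV[R]_n) : dot (c *: x) z = c * dot x z.
Proof. by rewrite !dotE -scalemxAl mxE. Qed.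

Lemma dotDr n (x y z : 'rV[R]_n) : dot z (x + y) = dot z x + dot z y.
Proof. by rewrite dotC dotDl !(dotC z). Qed.

Lemma dotZr n c (x z : 'rV[R]_n) : dot z (c *: x) = c * dot z x.
Proof. by rewrite dotC dotZl (dotC z). Qed.

Lemma dot_ge0 n (x : 'rV[R]_n) : 0 <= dot x x.
Proof. by apply: sumr_ge0 => i _; rewrite -expr2 sqr_ge0. Qed.

Lemma dot_eq0 n (x : 'rV[R]_n) : (dot x x == 0) = (x == 0).
Proof.
apply/idP/eqP => [|->]; last by rewrite /dot big1 // => i _; rewrite mxE mul0r.
rewrite psumr_eq0; last by move=> i _; rewrite -expr2 sqr_ge0.
move=> /allP x0; apply/rowP => i; rewrite mxE.
by have := x0 i; rewrite mem_index_enum -expr2 sqrf_eq0 => /(_ isT) /eqP.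
Qed.

Lemma dot_gt0 n (x : 'rV[R]_n) : x != 0 -> 0 < dot x x.
Proof. by move=> x0; rewrite lt_neqAle eq_sym dot_eq0 x0 dot_ge0. Qed.

Lemma dot_delta n (x : 'rV[R]_n) i : dot (delta_mx 0 i) x = x 0 i.
Proof. by rewrite dotE -rowE !mxE. Qed.

Lemma dot_scalar_mx (a b : R) : dot (a%:M : 'rV_1) b%:M = a * b.
Proof. by rewrite /dot big_ord1 !mxE eqxx !mulr1n. Qed.

Lemma dot_row_mx m n (x x' : 'rV[R]_m) (y y' : 'rV[R]_n) :
  dot (row_mx x y) (row_mx x' y') = dot x x' + dot y y'.
Proof. by rewrite !dotE tr_row_mx mul_row_col mxE. Qed.

(** Only this block of [G] meets second derivatives: the Hessians that occur are those of functions
    of [x], up to a term linear in the last coordinate, and vanish in the last row and column. *)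
Definition wblock n (G : 'rV[R]_(n + 1) -> 'M[R]_(n + 1)) (p : 'rV[R]_n) (s : R) :
  'M[R]_n := ulsubmx (G (row_mx p s%:M)).

(** [G p] annihilates [p], so only the component of [y] orthogonal to [p] contributes. *)
Lemma weight_psd m (G : 'rV[R]_m -> 'M[R]_m) p y :
  weight_matrix G -> p != 0 -> 0 <= form (G p) y y.
Proof.
move=> [sG pG _ kG] p0; have [sGp kGp] := (sG p p0, kG p p0).
have f0 z : form (G p) p z = 0 by rewrite /form kGp mul0mx mxE.
have f0' z : form (G p) z p = 0 by rewrite form_sym.
pose c := dot y p / dot p p; pose z := y - c *: p.
have -> : form (G p) y y = form (G p) z z.
  rewrite /z -scaleNr !(formDl, formDr, formZl, formZr) f0 f0' f0.
  by rewrite !mulr0 !addr0.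
have [->|z0] := eqVneq z 0; first by rewrite /form !mul0mx mxE.
rewrite form_dot; apply/ltW/pG => //.
rewrite /z -scaleNr dotDl dotZl /c mulNr divfK ?subrr //.
by rewrite dot_eq0.
Qed.

Lemma form_ulsubmx n (A : 'M[R]_(n + 1)) y z :
  form (ulsubmx A) y z = form A (row_mx y 0) (row_mx z 0).
Proof.
rewrite /form -[A in RHS]submxK tr_row_mx trmx0 mul_row_block !mul0mx !addr0.
by rewrite mul_row_col mulmx0 addr0.
Qed.

Lemma mxtrace_ulsubmx n (A : 'M[R]_(n + 1)) (D : 'M[R]_n) :
  \tr (A *m block_mx D 0 0 0) = \tr (ulsubmx A *m D).
Proof.
rewrite -[A in LHS]submxK mulmx_block !mulmx0 !addr0 mxtrace_block.
by rewrite mxtrace0 addr0.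
Qed.

Lemma row_mx_neq0l m n (p : 'rV[R]_m) (q : 'rV[R]_n) : p != 0 -> row_mx p q != 0.
Proof. by apply: contraNneq => /eqP; rewrite row_mx_eq0 => /andP[]. Qed.

Lemma row_mx_neq0r n (p : 'rV[R]_n) (s : R) : s != 0 -> row_mx p s%:M != 0.
Proof.
apply: contraNneq => /eqP; rewrite row_mx_eq0 => /andP[_ /eqP].
by move=> /matrixP /(_ 0 0); rewrite !mxE => /eqP.
Qed.

Lemma weight_scale m (G : 'rV[R]_m -> 'M[R]_m) p t : weight_matrix G ->
  p != 0 -> 0 < t -> G (t *: p) = t^-1 *: G p.
Proof.
by move=> [_ _ hG _] p0 t0; rewrite -(hG p t) // scalerA mulVf ?gt_eqF // scale1r.
Qed.

(** Graphs and boundaries of cylinders are both level sets: their second fundamental form is a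
    multiple of a Hessian [D] restricted to the tangent space, and [mxtrace_tangent] then eliminates
    the parametrization. *)
Lemma wmc_levelset n (G : 'rV[R]_(n + 1) -> 'M[R]_(n + 1))
    (X : 'rV[R]_n -> 'rV[R]_(n + 1)) N y D c :
  weight_matrix G -> row_free (\matrix_(i < n) pd i X y) -> N != 0 ->
  (forall i, dot (pd i X y) N = 0) ->
  (forall i j, dot (pd j (pd i X) y) N = c * form D (pd i X y) (pd j X y)) ->
  wmc G X N y = c * \tr (G N *m D).
Proof.
move=> [sG _ _ kG] fE N0 EN bE; set E := \matrix_(i < n) pd i X y in fE.
have rE i : row i E = pd i X y by rewrite rowK.
have fmE (A : 'M[R]_(n + 1)) :
    \matrix_(i < n, j < n) form A (pd i X y) (pd j X y) = E *m A *m E^T.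
  apply/matrixP => i j; rewrite mxE -!rE /form tr_row -row_mul mxE [RHS]mxE.
  by apply: eq_bigr => k _; rewrite [row _ _ _ _]mxE [col _ _ _ _]mxE.
have gE : \matrix_(i < n, j < n) dot (pd i X y) (pd j X y) = E *m E^T.
  rewrite -[X in _ = X *m _]mulmx1 -fmE; apply/matrixP => i j.
  by rewrite !mxE form_dot mulmx1.
have aE : \matrix_(i < n, j < n) dot (pd i X y *m G N) (pd j X y) = E *m G N *m E^T.
  by rewrite -fmE; apply/matrixP => i j; rewrite !mxE form_dot.
have bE' : \matrix_(i < n, j < n) dot (pd j (pd i X) y) N = c *: (E *m D *m E^T).
  by rewrite -fmE; apply/matrixP => i j; rewrite !mxE.
have NE : E *m N^T = 0.
  apply/matrixP => i j; rewrite -[LHS](mxE tt (fun i j => (E *m N^T) i j)) ord1.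
  by rewrite !mxE -[RHS](EN i) /dot; apply: eq_bigr => k _; rewrite !mxE.
rewrite /wmc gE aE bE' -!scalemxAr mxtraceZ; congr (_ * _).
by rewrite (mxtrace_tangent _ fE N0 NE) // ?sG ?kG.
Qed.

Lemma upper_normal_factor_gt0 n (u : 'rV[R]_n -> R) x : 0 < Num.sqrt (1 + enorm (grad u x) ^+ 2).
Proof. by rewrite sqrtr_gt0 ltr_pwDl // sqr_ge0. Qed.

Lemma derive_row_mx (V : normedModType R) m (f : V -> 'rV[R]_m) (g : V -> R) x v :
  derivable f x v -> derivable g x v ->
  is_derive x v (fun x => row_mx (f x) (g x)%:M)
    (row_mx ('D_v f x) ('D_v g x)%:M).
Proof.
move=> df dg.
have El i k : (fun x => row_mx (f x) (g x)%:M i (lshift 1 k)) = fun x => f x i k.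
  by apply/funext => y; rewrite row_mxEl.
have Er i k : (fun x => row_mx (f x) (g x)%:M i (rshift m k)) = g.
  by apply/funext => y; rewrite row_mxEr mxE !ord1 eqxx mulr1n.
have dr : derivable (fun x => row_mx (f x) (g x)%:M) x v.
  apply/derivable_mxP => i j; rewrite -(fintype.splitK j).
  case: (fintype.split j) => k /=; rewrite ?El ?Er //.
  by move/derivable_mxP : df; apply.
apply: DeriveDef => //; rewrite derive_mx //; apply/matrixP => i j; rewrite [LHS]mxE.
rewrite -(fintype.splitK j); case: (fintype.split j) => k /=.
  by rewrite El row_mxEl [in RHS]derive_mx // mxE.
by rewrite Er row_mxEr mxE !ord1 eqxx mulr1n.
Qed.

Lemma pd_graph_map n (u : 'rV[R]_n -> R) x i : derivable u x (delta_mx 0 i) ->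
  pd i (graph_map u) x = row_mx (delta_mx 0 i) (pd i u x)%:M.
Proof.
move=> du; have := @derive_row_mx 'rV[R]_n n id u x (delta_mx 0 i).
by move=> /(_ (@derivable_id _ _ _ _) du)[_]; rewrite derive_id.
Qed.

Lemma pd_pd_graph_map n (U : set 'rV[R]_n) (u : 'rV[R]_n -> R) x i j :
  open U -> U x -> Ck 2 U u ->
  pd j (pd i (graph_map u)) x = row_mx 0 (pd j (pd i u) x)%:M.
Proof.
move=> oU Ux [_ uU].
transitivity (pd j (fun x => row_mx (delta_mx 0 i : 'rV[R]_n) (pd i u x)%:M) x).
  apply: near_eq_derive; near=> y; rewrite pd_graph_map //.
  have [+ _] := uU i; apply; near: y; exact: open_nbhs_nbhs.
have [_ [_ /(_ j)[/(_ x Ux) du _]]] := uU i.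
have := @derive_row_mx 'rV[R]_n n (cst (delta_mx 0 i : 'rV[R]_n)) (pd i u) x (delta_mx 0 j).
by move=> /(_ (@derivable_cst _ _ _ _ _ _) du)[_]; rewrite derive_cst.
Unshelve. all: by end_near. Qed.

(** The factor [W^-1] in the second fundamental form cancels the factor [W] that homogeneity
    produces when [G] is evaluated at the normalized normal, so no square root survives. *)
Lemma prescribed_wmc_graphE n (G : 'rV[R]_(n + 1) -> 'M[R]_(n + 1))
    (Omega : set 'rV[R]_n) H u x :
  weight_matrix G -> open Omega -> Ck 2 Omega u ->
  prescribed_wmc_graph G Omega H u -> Omega x ->
  \tr (wblock G (- grad u x) 1 *m hess u x) = H (x, u x).
Proof.
move=> wG oO uO Hu Ox; rewrite -Hu //.
have W0 := upper_normal_factor_gt0 u x; set W := Num.sqrt _ in W0.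
have p0 := row_mx_neq0r (- grad u x) (oner_neq0 R).
have du i : derivable u x (delta_mx 0 i) by have [_ /(_ i)[+ _]] := uO; apply.
rewrite (@wmc_levelset _ G (graph_map u) _ x (block_mx (hess u x) 0 0 0) W^-1) //.
- rewrite /upper_normal -/W weight_scale // ?invr_gt0 // invrK.
  by rewrite -scalemxAl mxtraceZ mulrA mulVf ?gt_eqF // mul1r mxtrace_ulsubmx.
- apply/row_freeP; exists (col_mx 1%:M 0).
  have -> : \matrix_(i < n) pd i (graph_map u) x = row_mx 1%:M (grad u x)^T.
    apply/row_matrixP => i; rewrite rowK pd_graph_map // row_row_mx row1.
    by congr row_mx; apply/matrixP => a b; rewrite !mxE !ord1 eqxx mulr1n.
  by rewrite mul_row_col mulmx1 mulmx0 addr0.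
- by rewrite scaler_eq0 invr_eq0 gt_eqF.
- move=> i; rewrite dotZr pd_graph_map // dot_row_mx.
  by rewrite dot_delta dot_scalar_mx !mxE mulr1 addNr mulr0.
- move=> i j; rewrite (pd_pd_graph_map _ _ oO Ox uO) // !pd_graph_map //.
  rewrite dotZr dot_row_mx dot_scalar_mx mulr1 [dot 0 _]dotC -{1}(scale0r 0).
  rewrite dotZr mul0r add0r; congr (_ * _).
  rewrite /form mul_row_block tr_row_mx mul_row_col !mulmx0 !addr0.
  by rewrite mul0mx addr0 -/(form _ _ _) form_delta mxE.
Qed.
End weight.

(** * Defining functions of C^2 domains *)

Section domain.
Variable R : realType.

Lemma Ck_eq (W : normedModType R) n k (U : set 'rV[R]_n) (f g : 'rV[R]_n -> W) :
  open U -> (forall x, U x -> f x = g x) -> Ck k U f -> Ck k U g.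
Proof.
move=> oU; elim: k f g => [|k IH] f g fg /= [cf fU].
all: have nE x : U x -> \forall y \near x, f y = g y
  by move=> Ux; near=> y; apply/fg; near: y; exact: open_nbhs_nbhs.
all: have cg x : U x -> {for x, continuous g}
  by move=> Ux A gA; have := cf x Ux A; rewrite (fg x Ux) => /(_ gA) fA;
     have := nE x Ux; rewrite /= !nbhs_simpl /= in fA *;
     apply: filterS2 fA => y /= fyA <-.
  by split.
split => //.
move=> i; have [df ckf] := fU i; split.
  by move=> x Ux; apply: near_eq_derivable (df x Ux); exact: nE.
by apply: IH ckf => x Ux; apply: near_eq_derive; exact: nE.
Unshelve. all: by end_near. Qed.

Lemma Ck_coord m p n k (U : set 'rV[R]_n) (f : 'rV[R]_n -> 'M[R]_(m, p)) i j :
  open U -> Ck k U f -> Ck k U (fun x => f x i j).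
Proof.
move=> oU; have cc (h : 'rV[R]_n -> 'M[R]_(m, p)) x :
  {for x, continuous h} -> {for x, continuous (fun x => h x i j)}.
  move=> ch; apply: (@continuous_comp _ _ _ h (fun M : 'M[R]_(m, p) => M i j)) => //.
  exact: coord_continuous.
elim: k f => [|k IH] f /= [cf fU]; first by split => // x Ux; exact/cc/cf.
split; first by move=> x Ux; exact/cc/cf.
move=> l; have [df ckf] := fU l; split.
  by move=> x Ux; have /derivable_mxP := df x Ux; exact.
apply: (@Ck_eq _ _ _ _ (fun x => pd l f x i j)) => //; last exact: IH.
by move=> x Ux; rewrite /pd; have [_ ->] := is_derive_coord i j (df x Ux).
Qed.

Lemma derive_gt0_right (f : R -> R) (d : R) :
  is_derive (0 : R) (1 : R) f d -> 0 < d -> \forall t \near 0^'+, f 0 < f t.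
Proof.
move=> [dd dE] d0.
have [r /= r0 rP] : \forall h \near (0:R)^', 0 < h^-1 * (f (h + 0) - f 0).
  have /cvgrPdist_lt /(_ d d0) : h^-1 * (f (h * 1 + 0) - f 0) @[h --> (0:R)^'] --> d.
    by move: dd; rewrite /derivable -dE.
  apply: filterS => h; rewrite mulr1 ltr_distlC; lra.
exists r => //= t; rewrite /ball_ /= => tr t0.
have := rP t tr; rewrite /= addr0 gt_eqF // => /(_ isT).
by rewrite pmulr_rgt0 ?invr_gt0 // subr_gt0.
Qed.

Lemma bdry_open n (Omega : set 'rV[R]_n) x : open Omega ->
  bdry Omega x -> closure Omega x /\ ~ Omega x.
Proof. by move=> /interior_id oO []; rewrite oO. Qed.

(** The part of [A] inside [Omega] is open in [A]. It is also closed in [A]: as [A] avoids the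
    boundary, it is the part of [A] inside [closure Omega]. *)
Lemma connected_avoids_bdry (T : topologicalType) (Omega A : set T) : open Omega ->
  connected A -> (forall x, A x -> ~ bdry Omega x) -> A `&` Omega !=set0 ->
  A `<=` Omega.
Proof.
move=> oO cA nA A0; have -> : A = A `&` Omega; last by move=> ? [].
apply/esym; apply: cA => //; first by exists Omega.
exists (closure Omega); first exact: closed_closure.
apply/seteqP; split => x [Ax Ox]; split => //; first exact: subset_closure.
apply: contrapT => nO; apply: (nA x Ax); split => //.
by move=> /interior_subset.
Qed.

(** The sign conditions start from points known to lie in [Omega] or on its boundary. The last
    clause goes the other way and produces points of [Omega], on rays along which boundary
    derivatives are computed. *)
Definition defining_function n (Omega B : set 'rV[R]_n) (rho : 'rV[R]_n -> R) :=
  [/\ open B, Ck 2 B rho, (forall x, B x -> grad rho x != 0),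
      (forall x, B x -> Omega x -> 0 < rho x) /\
      (forall x, B x -> bdry Omega x -> rho x = 0)
    & forall x y, B x -> bdry Omega x -> 0 < dot y (grad rho x) ->
        \forall t \near (0 : R)^'+, Omega (x + t *: y)].

(** [rho] is the chart component that vanishes on the boundary. Its gradient cannot vanish: composed
    with [theta] it is the [i]-th coordinate, whose derivative along axis [i] is 1. *)
Lemma C2_domain_defining_function n (Omega : set 'rV[R]_n) z :
  C2_domain Omega -> bdry Omega z ->
  exists B rho, B z /\ defining_function Omega B rho.
Proof.
move=> [oO _ _ charts] /charts[i [B [psi [theta [[oB Bz] [opB thK]]]]]].
move=> [psiC thC] pos bd0; exists B, (fun x => psi x 0 i); split => //.
have rhoC : Ck 2 B (fun x => psi x 0 i) by exact: Ck_coord.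
have linE (x y : 'rV[R]_n) : B x ->
    is_derive (0 : R) (1 : R) (fun s : R => psi (x + s *: y) 0 i)
      (dot y (grad (fun x => psi x 0 i) x)).
  move=> Bx; have := @C1_line R n B (fun x => psi x 0 i) x y 0 oB (C2_C1 rhoC).
  by rewrite scale0r addr0; apply.
have cpsi x : B x -> {for x, continuous psi} by move: psiC => [+ _]; apply.
have cth y : (psi @` B) y -> {for y, continuous theta}.
  by move: thC => [+ _]; apply.
split => //.
- move=> x Bx; apply/negP => /eqP g0.
  have dth : derivable theta (psi x) (delta_mx 0 i).
    by have [_ /(_ i)[+ _]] := thC; apply; exists x.
  have thx : B (theta (psi x)) by rewrite thK.
  have [_] := C1_chain oB (C2_C1 rhoC) thx dth.
  rewrite thK // g0 => D0.
  have : 'D_(delta_mx 0 i) (fun y : 'rV[R]_n => y 0 i) (psi x) = 0.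
    rewrite -[RHS](_ : dot ('D_(delta_mx 0 i) theta (psi x)) 0 = 0); last first.
      by rewrite /dot big1 // => k _; rewrite mxE mulr0.
    rewrite -D0; apply: near_eq_derive.
    near=> y; have [x' Bx' <-] : (psi @` B) y.
      by near: y; apply: open_nbhs_nbhs; split => //; exists x.
    by rewrite /= thK.
  have [_ ->] := is_derive_coord 0 i (@derivable_id _ _ (psi x) (delta_mx 0 i)).
  by rewrite derive_id !mxE !eqxx => /eqP; rewrite oner_eq0.
- move=> x y Bx bdx gy.
  have /nbhs_ballP[d /= d0 dB] : nbhs (psi x) (psi @` B).
    by apply: open_nbhs_nbhs; split => //; exists x.
  have bE (w : 'rV[R]_n) : ball (psi x) d w <-> `|psi x - w| < d by rewrite -ball_normE.
  (* The chart image of [x1] is joined by a straight segment to the image of a nearby point [x2] of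
     [Omega]. The [i]-th coordinate stays positive on the segment, so its pullback by [theta] avoids
     the boundary and cannot leave [Omega]. *)
  have inside x1 : B x1 -> `|psi x - psi x1| < d -> 0 < psi x1 0 i -> Omega x1.
    move=> Bx1 dx1 px1.
    have [x2 [Ox2 [Bx2 dx2]]] : Omega `&` (B `&` [set w | `|psi x - psi w| < d]) !=set0.
      have [cx _] := bdry_open oO bdx; apply: cx; apply: filterI.
        exact: open_nbhs_nbhs.
      by have /cvgrPdist_lt /(_ d d0) := cpsi x Bx.
    have px2 := pos x2 Bx2 Ox2.
    pose c (t : R) := psi x2 + t *: (psi x1 - psi x2).
    have cE t : c t = (1 - t) *: psi x2 + t *: psi x1.
      by apply/rowP => j; rewrite /c !mxE; ring.
    have c01 (t : R) : 0 <= t <= 1 -> (psi @` B) (c t) /\ 0 < c t 0 i.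
      move=> /andP[t0 t1]; split.
        apply: dB; apply/bE; rewrite cE.
        have -> : psi x - ((1 - t) *: psi x2 + t *: psi x1) =
            (1 - t) *: (psi x - psi x2) + t *: (psi x - psi x1).
          by apply/rowP => j; rewrite !mxE; ring.
        apply: le_lt_trans (ler_normD _ _) _; rewrite !normrZ.
        rewrite !ger0_norm ?subr_ge0 //.
        have [->|tn0] := eqVneq t 0; first by rewrite subr0 mul1r mul0r addr0.
        have -> : d = (1 - t) * d + t * d by ring.
        apply: ler_ltD; first by apply: ler_wpM2l; rewrite ?subr_ge0 // ltW.
        by rewrite ltr_pM2l // lt_neqAle eq_sym tn0.
      rewrite cE !mxE.
      have [->|tn0] := eqVneq t 0; first by rewrite subr0 mul1r mul0r addr0.
      apply: ltr_wpDl; first by rewrite mulr_ge0 ?subr_ge0 // ltW.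
      by rewrite mulr_gt0 // lt_neqAle eq_sym tn0.
    have cc : connected ((theta \o c) @` `[0, 1]).
      apply: connected_continuous_connected; first exact: segment_connected.
      apply: continuous_in_subspaceT => t; rewrite inE /= in_itv /= => t01.
      apply: continuous_comp; last by apply: cth; have [] := c01 t t01.
      apply: cvgD; first exact: cvg_cst.
      exact: scalel_continuous.
    apply: (connected_avoids_bdry oO cc).
    - move=> w [t]; rewrite /= in_itv /= => t01 <-.
      have [[x' Bx' xE] ct] := c01 t t01.
      rewrite /= -xE thK // => /(bd0 _ Bx') p0.
      by move: ct; rewrite -xE p0 ltxx.
    - exists x2; split => //; exists 0; rewrite /= ?in_itv /= ?lexx ?ler01 //.
      by rewrite /c scale0r addr0 thK.
    - exists 1; rewrite /= ?in_itv /= ?lexx ?ler01 //.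
      by rewrite /c scale1r addrC subrK thK.
  have cl : (x + t *: y) @[t --> (0 : R)^'+] --> x.
    rewrite -[X in _ --> X]addr0 -(scale0r y); apply: cvgD; first exact: cvg_cst.
    by apply: cvg_at_right_filter; apply: scalel_continuous.
  have h1 : \forall t \near (0 : R)^'+, B (x + t *: y).
    by have := cl B; apply; apply: open_nbhs_nbhs.
  have h2 : \forall t \near (0 : R)^'+, `|psi x - psi (x + t *: y)| < d.
    have := cl [set w | `|psi x - psi w| < d]; apply.
    by have /cvgrPdist_lt /(_ d d0) := cpsi x Bx.
  near=> t; apply: inside.
  - by near: t.
  - by near: t.
  - rewrite -(bd0 x Bx bdx) -[x in psi x 0 i < _]addr0 -(scale0r y).
    by near: t; apply: derive_gt0_right (linE x y Bx) gy.
Unshelve. all: by end_near. Qed.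

End domain.

(** * Curvature of the boundary *)

Section bdry_curvature.
Variable R : realType.

Lemma normal_line n (E : 'M[R]_(n, n + 1)) (v w : 'rV[R]_(n + 1)) :
  row_free E -> v != 0 -> E *m v^T = 0 -> E *m w^T = 0 -> exists c, w = c *: v.
Proof.
move=> fE v0 Ev Ew.
have inK (x : 'rV[R]_(n + 1)) : E *m x^T = 0 -> (x <= kermx E^T)%MS.
  by move=> Ex; apply/sub_kermxP; rewrite -[x]trmxK -trmx_mul Ex trmx0.
have rK : \rank (kermx E^T) = 1%N.
  by rewrite mxrank_ker mxrank_tr (eqP fE) addKn.
have Kv : (kermx E^T <= v)%MS.
  by rewrite -(geq_leqif (mxrank_leqif_sup (inK v Ev))) rK rank_rV v0.
have /submxP[C wC] := submx_trans (inK w Ew) Kv.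
by exists (C 0 0); rewrite {1}wC [C]mx11_scalar mul_scalar_mx !mxE eqxx mulr1n.
Qed.

Lemma bdry_cylinder n (Omega : set 'rV[R]_n) p : open Omega ->
  bdry (cylinder Omega) p -> bdry Omega (lsubmx p).
Proof.
move=> oO [clp ip]; have cl : continuous (@lsubmx R 1 n 1) by exact: continuous_lsubmx.
split.
  by move=> A /cl Ap; have [q [Oq Aq]] := clp _ Ap; exists (lsubmx q).
move=> /interior_subset Op; apply: ip.
by apply: (cl p Omega); exact: open_nbhs_nbhs.
Qed.

Lemma derive_lsubmx (V : normedModType R) m1 m2 (f : V -> 'rV[R]_(m1 + m2)) x v :
  derivable f x v -> is_derive x v (fun x => lsubmx (f x)) (lsubmx ('D_v f x)).
Proof.
move=> df; have dl : derivable (fun x => lsubmx (f x)) x v.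
  apply/derivable_mxP => i j.
  rewrite (_ : (fun x => _) = fun x => f x i (lshift m2 j)); last first.
    by apply/funext => y; rewrite mxE.
  by move/derivable_mxP : df; apply.
apply: DeriveDef => //; rewrite derive_mx //; apply/matrixP => i j.
have [_ E] := is_derive_coord i (lshift m2 j) df.
rewrite [LHS]mxE [RHS]mxE -E (_ : (fun x => lsubmx (f x) i j) = fun x => f x i (lshift m2 j)) //.
by apply/funext => y; rewrite mxE.
Qed.

Lemma is_derive_mul (V : normedModType R) (f g : V -> R) x v df dg :
  is_derive x v f df -> is_derive x v g dg ->
  is_derive x v (fun y => f y * g y) (f x * dg + g x * df).
Proof. by move=> hf hg; exact: (is_deriveM hf hg). Qed.

(* Differentiating [rho (lsubmx (X y)) = 0] twice. *)
Lemma levelset_second_form n (B U : set 'rV[R]_n) (rho : 'rV[R]_n -> R)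
    (X : 'rV[R]_n -> 'rV[R]_(n + 1)) y :
  open B -> Ck 2 B rho -> open U -> Ck 2 U X -> U y -> B (lsubmx (X y)) ->
  (\forall y' \near y, rho (lsubmx (X y')) = 0) ->
  let nu := grad rho (lsubmx (X y)) in
  (forall i, dot (lsubmx (pd i X y)) nu = 0) /\
  forall i j, dot (lsubmx (pd j (pd i X) y)) nu =
    - form (hess rho (lsubmx (X y))) (lsubmx (pd i X y)) (lsubmx (pd j X y)).
Proof.
move=> oB rhoC oU XC Uy By rho0 nu.
have dX y' i : U y' -> derivable X y' (delta_mx 0 i).
  by move=> Uy'; have [_ /(_ i)[+ _]] := XC; apply.
have dY y' i : U y' -> is_derive y' (delta_mx 0 i) (fun y => lsubmx (X y))
    (lsubmx (pd i X y')).
  by move=> Uy'; apply: derive_lsubmx; exact: dX.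
have cX : {for y, continuous X} by have [+ _] := XC; apply.
have cY : (fun y => lsubmx (X y)) @ y --> lsubmx (X y).
  exact: (continuous_comp cX (@continuous_lsubmx R 1 n 1 (X y))).
have nB : \forall y' \near y, B (lsubmx (X y')).
  by have BY : nbhs (lsubmx (X y)) B by [exact: open_nbhs_nbhs]; exact: (cY B BY).
have nU : \forall y' \near y, U y' by exact: open_nbhs_nbhs.
have chain (f : 'rV[R]_n -> R) y' i : Ck 1 B f -> U y' -> B (lsubmx (X y')) ->
    is_derive y' (delta_mx 0 i) (fun y => f (lsubmx (X y)))
      (dot (lsubmx (pd i X y')) (grad f (lsubmx (X y')))).
  move=> fC Uy' By'; have [dd dE] := dY y' i Uy'.
  have := @C1_chain R _ n B f (fun y => lsubmx (X y)) y' (delta_mx 0 i) oB fC By' dd.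
  by rewrite dE.
(* The first order identity is kept for all [y'] near [y], so that it can be differentiated
   again. *)
have first i : \forall y' \near y, dot (lsubmx (pd i X y')) (grad rho (lsubmx (X y'))) = 0.
  near=> y'.
  have Uy' : U y' by near: y'.
  have By' : B (lsubmx (X y')) by near: y'.
  have [_ <-] := chain rho y' i (C2_C1 rhoC) Uy' By'.
  transitivity ('D_(delta_mx 0 i) (cst (0 : R)) y').
    by apply: near_eq_derive; near: y'; exact: nbhs_interior rho0.
  by rewrite derive_cst.
split; first by move=> i; exact: (nbhs_singleton (first i)).
move=> i j.
have dXX : derivable (pd i X) y (delta_mx 0 j).
  by have [_ /(_ i)[_ [_ /(_ j)[+ _]]]] := XC; apply.
have := near_eq_derive (delta_mx 0 j) (first i); rewrite derive_cst.
rewrite (_ : (fun a => dot _ _) = (fun y => \sum_k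
    (lsubmx (pd i X y)) 0 k * pd k rho (lsubmx (X y)))); last first.
  by apply/funext => y'; apply: eq_bigr => k _; rewrite [grad _ _ _ _]mxE.
pose dh k (y : 'rV[R]_n) := (lsubmx (pd i X y)) 0 k *
    dot (lsubmx (pd j X y)) (grad (pd k rho) (lsubmx (X y))) +
  pd k rho (lsubmx (X y)) * (lsubmx (pd j (pd i X) y)) 0 k.
have [|_ ->] := @is_derive_sum_ord R 'rV[R]_n n (fun k y =>
   (lsubmx (pd i X y)) 0 k * pd k rho (lsubmx (X y))) dh y (delta_mx 0 j).
  move=> k; apply: is_derive_mul.
    have [dd dE] := derive_lsubmx dXX.
    by have := is_derive_coord 0 k dd; rewrite dE.
  by apply: chain => //; exact: C2_C1pd.
rewrite big_split /= => /eqP; rewrite addrC addr_eq0 => /eqP s0.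
transitivity (\sum_k pd k rho (lsubmx (X y)) * (lsubmx (pd j (pd i X) y)) 0 k).
  by apply: eq_bigr => k _; rewrite [nu _ _]mxE mulrC.
rewrite s0 formE; congr (- _); apply: eq_bigr => k _; congr (_ * _).
by apply: eq_bigr => l _; rewrite !mxE.
Unshelve. all: by end_near. Qed.

(** The normal is a nonzero multiple [t] of [(grad rho, 0)]. Homogeneity of [G] cancels the size of
    [t], and the inner or outer condition determines its sign; so the value is the same for all
    parametrizations. *)
Lemma bdry_wmc_atE n inner (G : 'rV[R]_(n + 1) -> 'M[R]_(n + 1))
    (Omega B : set 'rV[R]_n) rho x h :
  open Omega -> weight_matrix G -> defining_function Omega B rho -> B x ->
  bdry Omega x -> bdry_wmc_at inner G Omega x h ->
  h = if inner then - \tr (wblock G (grad rho x) 0 *m hess rho x)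
      else \tr (wblock G (- grad rho x) 0 *m hess rho x).
Proof.
move=> oO wG [oB rhoC grad0 [pos bd0] _] Bx bdx.
move=> [U [X [y [z [N [[oU Uy] [[XC Xfree] Xbd] Xy [[N1 XN] Nin] ->]]]]]].
have lX : lsubmx (X y) = x by rewrite Xy row_mxKl.
have cX : {for y, continuous X} by have [+ _] := XC; apply.
have cY : (fun y => lsubmx (X y)) @ y --> lsubmx (X y).
  exact: (continuous_comp cX (@continuous_lsubmx R 1 n 1 (X y))).
have rho0 : \forall y' \near y, rho (lsubmx (X y')) = 0.
  have nB : \forall y' \near y, B (lsubmx (X y')).
    have By : B (lsubmx (X y)) by rewrite lX.
    by have BY : nbhs (lsubmx (X y)) B by [exact: open_nbhs_nbhs]; exact: (cY B BY).
  have nU : \forall y' \near y, U y' by exact: open_nbhs_nbhs.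
  near=> y'; apply: bd0; first by near: y'.
  by apply: bdry_cylinder => //; apply: Xbd; near: y'.
have By : B (lsubmx (X y)) by rewrite lX.
have [e1 e2] := levelset_second_form oB rhoC oU XC Uy By rho0.
rewrite lX in e1 e2; set nu := grad rho x in e1 e2 *.
have nu0 : nu != 0 by exact: grad0.
pose v : 'rV[R]_(n + 1) := row_mx nu 0.
have v0 : v != 0 by exact: row_mx_neq0l.
have dotv (q : 'rV[R]_(n + 1)) : dot q v = dot (lsubmx q) nu.
  by rewrite -[q in LHS]hsubmxK dot_row_mx [dot _ 0]dotC -{1}(scale0r 0) dotZl mul0r addr0.
have fE := Xfree y Uy; set E := \matrix_i pd i X y in fE.
have Edot (w : 'rV[R]_(n + 1)) : (forall i, dot (pd i X y) w = 0) -> E *m w^T = 0.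
  move=> Ew; apply/matrixP => i j; rewrite ord1 [LHS]mxE [RHS]mxE -[RHS](Ew i).
  by apply: eq_bigr => k _; rewrite !mxE.
have [t Nt] : exists t, N = t *: v.
  by apply: (normal_line fE v0); apply: Edot => // i; rewrite dotv.
have N0 : N != 0.
  apply: contra_eq_neq N1 => ->; rewrite /enorm -(scale0r 0) dotZl mul0r sqrtr0.
  by rewrite eq_sym oner_eq0.
have t0 : t != 0 by apply: contra_neq N0 => t0; rewrite Nt t0 scale0r.
have -> : wmc G X N y = - t * \tr (G N *m block_mx (hess rho x) 0 0 0).
  apply: wmc_levelset => // i j.
  rewrite Nt dotZr dotv e2 mulNr mulrN; congr (- (_ * _)).
  rewrite -[pd i X y in RHS]hsubmxK -[pd j X y in RHS]hsubmxK.
  rewrite /form mul_row_block tr_row_mx mul_row_col !mulmx0 !addr0.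
  by rewrite mul0mx addr0.
have wE p : wblock G p 0 = ulsubmx (G (row_mx p 0)).
  rewrite /wblock; congr (ulsubmx (G (row_mx _ _))).
  by apply/matrixP => a b; rewrite !mxE mul0rn.
(* For negative [s], [rho] would drop below 0 along a ray that lies over [Omega], where [rho] is
   positive. *)
have sgn s : points_into (cylinder Omega) (X y) (s *: v) -> 0 <= s.
  move=> pin; rewrite leNgt; apply/negP => s0.
  have lin := @C1_line R n B rho x (s *: nu) 0 oB (C2_C1 rhoC).
  rewrite scale0r addr0 in lin; have {}lin := lin Bx.
  have d0 : 0 < - dot (s *: nu) (grad rho x).
    by rewrite dotZl -mulNr mulr_gt0 ?oppr_gt0 // dot_gt0.
  have := derive_gt0_right (is_deriveN lin) d0.
  have cl : (x + t *: (s *: nu)) @[t --> (0 : R)^'+] --> x.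
    rewrite -[X in _ --> X]addr0 -(scale0r (s *: nu)).
    apply: cvgD; first exact: cvg_cst.
    by apply: cvg_at_right_filter; apply: scalel_continuous.
  have nB : \forall t \near (0 : R)^'+, B (x + t *: (s *: nu)).
    by have := cl B; apply; apply: open_nbhs_nbhs.
  move=> nN; suff : (0 : R)^'+ set0 by exact: filter_not_empty.
  apply: filterS3 pin nB nN => r; rewrite /cylinder /= Xy.
  have -> : row_mx x z%:M + r *: (s *: v) = row_mx (x + r *: (s *: nu)) z%:M.
    by rewrite /v !scale_row_mx add_row_mx !scaler0 addr0.
  rewrite row_mxKl !fctE scale0r addr0 => Or Br.
  by rewrite (bd0 x Bx bdx) oppr0 oppr_gt0 => /lt_trans/(_ (pos _ Br Or)); rewrite ltxx.
case: inner Nin => Nin.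
  have tp : 0 < t by rewrite lt_neqAle eq_sym t0 sgn // -Nt.
  rewrite Nt weight_scale // -scalemxAl mxtraceZ mulrA mulNr mulfV // mulN1r.
  by rewrite mxtrace_ulsubmx wE.
have tp : 0 < - t by rewrite oppr_gt0 lt_neqAle t0 -oppr_ge0 sgn // scaleNr -Nt.
have -> : N = - t *: row_mx (- nu) 0.
  by rewrite Nt /v !scale_row_mx !scaler0 scaleNr scalerN opprK.
rewrite weight_scale //; last by apply: row_mx_neq0l; rewrite oppr_eq0.
rewrite -scalemxAl mxtraceZ mulrA mulfV ?gt_eqF // mul1r.
by rewrite mxtrace_ulsubmx wE.
Unshelve. all: by end_near. Qed.

(** A nonzero value excludes the default 0 of [xget], so some parametrization exists and need not be
    constructed. The sign assumptions on the curvature supply this where the lemma is applied. *)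
Lemma H_plusE n (G : 'rV[R]_(n + 1) -> 'M[R]_(n + 1)) (Omega B : set 'rV[R]_n) rho x :
  open Omega -> weight_matrix G -> defining_function Omega B rho -> B x ->
  bdry Omega x -> H_plus G Omega x != 0 ->
  H_plus G Omega x = - \tr (wblock G (grad rho x) 0 *m hess rho x).
Proof.
move=> oO wG rhoD Bx bdx; rewrite /H_plus; case: xgetP => [h _ hh _|_].
  exact: (@bdry_wmc_atE n true G Omega B rho x h oO wG rhoD Bx bdx hh).
by rewrite eqxx.
Qed.

Lemma H_minusE n (G : 'rV[R]_(n + 1) -> 'M[R]_(n + 1)) (Omega B : set 'rV[R]_n) rho x :
  open Omega -> weight_matrix G -> defining_function Omega B rho -> B x ->
  bdry Omega x -> H_minus G Omega x != 0 ->
  H_minus G Omega x = \tr (wblock G (- grad rho x) 0 *m hess rho x).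
Proof.
move=> oO wG rhoD Bx bdx; rewrite /H_minus; case: xgetP => [h _ hh _|_].
  exact: (@bdry_wmc_atE n false G Omega B rho x h oO wG rhoD Bx bdx hh).
by rewrite eqxx.
Qed.

End bdry_curvature.

(** * Moduli of continuity *)

Section moduli.
Variable R : realType.

Lemma half_lt (r : R) : 0 < r -> r / 2 < r.
Proof. lra. Qed.

Lemma mulr_half_cancel (x e : R) : 0 < x -> x * (e / (2 * x)) = e / 2.
Proof. by move=> x0; field; rewrite gt_eqF. Qed.

Lemma within_continuous_dist (V W : normedModType R) (A : set V) (f : V -> W) x e :
  {within A, continuous f} -> A x -> 0 < e ->
  exists2 r : R, 0 < r & forall y, A y -> `|x - y| < r -> `|f x - f y| < e.
Proof.
move=> /subspace_continuousP cf Ax e0.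
have /cvgrPdist_lt /(_ e e0) := cf x Ax.
rewrite near_withinE => /nbhs_normP[r /= r0 rP].
by exists r => // y Ay xy; apply: rP.
Qed.

(** Compactness is used as near covering: a property that holds near each point for all small [d]
    holds on the whole of [A] for all small [d]. This replaces finite subcovers. *)
Lemma compact_unif_continuous (V W : normedModType R) (A : set V) (f : V -> W) e :
  compact A -> {within A, continuous f} -> 0 < e ->
  exists2 d : R, 0 < d & forall x y, A x -> A y -> `|x - y| <= d -> `|f x - f y| <= e.
Proof.
move=> cA cf e0.
have /near_covering_withinP cov := (compact_near_coveringP A).1 cA.
have := cov R (0 : R)^'+ (fun d x => forall y, A y -> `|x - y| <= d -> `|f x - f y| <= e).
case.
- move=> x Ax; have e2 : 0 < e / 2 by rewrite divr_gt0.
  have [r r0 rP] := within_continuous_dist cf Ax e2.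
  have r2 := half_lt r0.
  near=> x' d => Ax' y Ay xy.
  have xx' : `|x - x'| < r / 2.
    by near: x'; apply/nbhs_normP; exists (r / 2) => //=; rewrite divr_gt0.
  have dr : d < r / 2.
    by near: d; apply: nbhs_right_lt; rewrite divr_gt0.
  have h1 : `|f x - f x'| < e / 2 by apply: rP => //; exact: lt_trans xx' r2.
  have h2 : `|f x - f y| < e / 2.
    apply: rP => //; rewrite -(subrKA x') (le_lt_trans (ler_normD _ _)) //.
    rewrite [ltRHS]splitr.
    by apply: ltrD => //; apply: le_lt_trans dr.
  rewrite -(subrKA (f x)) (le_trans (ler_normD _ _)) // distrC [leRHS]splitr.
  by apply: lerD; exact: ltW.
- move=> r r0 rP; exists (r / 2); first by rewrite divr_gt0.
  move=> x y Ax Ay xy.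
  apply: (rP (r / 2)) => //=; last by rewrite divr_gt0.
  by rewrite /ball_ /= sub0r normrN gtr0_norm ?divr_gt0 // half_lt.
Unshelve. all: by end_near. Qed.

Lemma modulus_small (V W : normedModType R) (A : set V) (f : V -> W) e :
  compact A -> {within A, continuous f} -> 0 < e ->
  exists2 d : R, 0 < d & modulus A f d <= e.
Proof.
move=> cA cf e0; have [d d0 dP] := compact_unif_continuous cA cf e0.
exists d => //; rewrite /modulus; set S := [set r | _].
have [->|/set0P S0] := eqVneq S set0; first by rewrite sup0 ltW.
by apply: ge_sup => // r [x [y [Ax Ay xy ->]]]; exact: dP.
Qed.

(** Compactness bounds the oscillations, so that [sup] is a genuine supremum and not its default
    value. *)
Lemma modulus_ge (V W : normedModType R) (A : set V) (f : V -> W) t x y :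
  compact A -> {within A, continuous f} -> A x -> A y -> `|x - y| <= t ->
  `|f x - f y| <= modulus A f t.
Proof.
move=> cA cf Ax Ay xy; apply: ub_le_sup; last by exists x, y.
have [b [_ bP]] : bounded_set (f @` A).
  exact/compact_bounded/continuous_compact.
exists (b + 1 + (b + 1)) => _ [p [q [Ap Aq _ ->]]].
apply: le_trans (ler_normB _ _) _; apply: lerD; apply: (bP (b + 1)); rewrite ?ltrDl //.
Qed.

(** * Weight matrices with a given modulus on the unit sphere *)

Lemma enorm_continuous m : continuous (@enorm R m).
Proof.
move=> p; rewrite /enorm.
apply: (@continuous_comp _ _ _ (fun x : 'rV[R]_m => dot x x) Num.sqrt); last first.
  exact: sqrt_continuous.
apply: (@cvg_sum_ord R _ (nbhs p) _ m (fun i (x : 'rV[R]_m) => x 0 i * x 0 i)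
  (fun i => p 0 i * p 0 i)) => i.
by apply: cvgM; exact: coord_continuous.
Qed.

Lemma norm_le_enorm m (p : 'rV[R]_m) : `|p| <= enorm p.
Proof.
apply: mx_norm_le => [|i j]; first exact: sqrtr_ge0.
rewrite ord1 -sqrtr_sqr ler_wsqrtr // /dot (bigD1 j) //= -expr2 lerDl.
by apply: sumr_ge0 => k _; rewrite -expr2 sqr_ge0.
Qed.

Lemma enorm_eq0 m (p : 'rV[R]_m) : (enorm p == 0) = (p == 0).
Proof. by rewrite /enorm sqrtr_eq0 -dot_eq0 eq_le dot_ge0 andbT. Qed.

Lemma enorm_gt0 m (p : 'rV[R]_m) : p != 0 -> 0 < enorm p.
Proof. by move=> p0; rewrite lt_neqAle eq_sym enorm_eq0 p0 sqrtr_ge0. Qed.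

Lemma enormZ m c (p : 'rV[R]_m) : 0 <= c -> enorm (c *: p) = c * enorm p.
Proof.
move=> c0; rewrite /enorm dotZl dotZr mulrA -expr2 sqrtrM ?sqr_ge0 //.
by rewrite sqrtr_sqr ger0_norm.
Qed.

Lemma sphere_compact m : compact [set p : 'rV[R]_m | enorm p = 1].
Proof.
apply: bounded_closed_compact.
  exists 1; split => // x x1 p /= p1.
  by rewrite (le_trans (norm_le_enorm p)) // p1 ltW.
have -> : [set p : 'rV[R]_m | enorm p = 1] = (@enorm R m) @^-1` [set 1] by [].
apply: closed_comp; first by move=> p _; exact: enorm_continuous.
exact: closed_eq.
Qed.

(** Fixing the modulus instead of the matrix lets later radii be chosen from [om] alone, before [G]
    is introduced. *)
Definition weight_class m (om : R -> R) (G : 'rV[R]_m -> 'M[R]_m) :=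
  [/\ weight_matrix G, forall p, p != 0 -> {for p, continuous G}
    & modulus_weight G = om].

Lemma sphere_neq0 m (p : 'rV[R]_m) : enorm p = 1 -> p != 0.
Proof. by move=> p1; rewrite -enorm_eq0 p1 oner_neq0. Qed.

Lemma weight_within_continuous m om (G : 'rV[R]_m -> 'M[R]_m) : weight_class om G ->
  {within [set p | enorm p = 1], continuous G}.
Proof.
move=> [_ cG _]; apply: continuous_in_subspaceT => p; rewrite inE => /sphere_neq0.
exact: cG.
Qed.

Lemma weight_modulus m om (G : 'rV[R]_m -> 'M[R]_m) p q t : weight_class om G ->
  enorm p = 1 -> enorm q = 1 -> `|p - q| <= t -> `|G p - G q| <= om t.
Proof.
move=> wG p1 q1 pq; have [_ _ <-] := wG; rewrite /modulus_weight.
by apply: modulus_ge => //; [exact: sphere_compact|exact: weight_within_continuous wG].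
Qed.

(* [G e_j] kills [e_j], so the oscillation of [G] on the sphere bounds [G]. *)
Lemma weight_bound m om (G : 'rV[R]_m -> 'M[R]_m) p : weight_class om G ->
  enorm p = 1 -> `|G p| <= om 2.
Proof.
move=> wG p1.
(* Unit vectors are at distance at most 2 from each other, whence the argument of [om]. *)
have diam (q : 'rV[R]_m) : enorm q = 1 -> `|p - q| <= 2.
  move=> q1; rewrite (le_trans (ler_normB _ _)) //.
  have := norm_le_enorm p; have := norm_le_enorm q; rewrite p1 q1; lra.
have om0 : 0 <= om 2.
  by apply: le_trans (weight_modulus wG p1 p1 (diam p p1)); exact: normr_ge0.
apply: mx_norm_le => // i j; pose q : 'rV[R]_m := delta_mx 0 i.
have q1 : enorm q = 1 by rewrite /enorm dot_delta mxE !eqxx sqrtr1.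
have Gq : G q i j = 0.
  have [[_ _ _ kG] _ _] := wG.
  have /matrixP/(_ 0 j) := kG q (sphere_neq0 q1).
  by rewrite -rowE !mxE.
have := weight_modulus wG p1 q1 (diam q q1); apply: le_trans.
by have := ler_mxe (G p - G q) i j; rewrite !mxE Gq subr0.
Qed.

Lemma weight_normalize m om (G : 'rV[R]_m -> 'M[R]_m) p : weight_class om G ->
  p != 0 -> G p = (enorm p)^-1 *: G ((enorm p)^-1 *: p).
Proof.
move=> [wG _ _] p0; have ep := enorm_gt0 p0.
by rewrite weight_scale ?invr_gt0 // invrK scalerA mulVf ?scale1r ?gt_eqF.
Qed.

Lemma enorm_normalize m (p : 'rV[R]_m) : p != 0 -> enorm ((enorm p)^-1 *: p) = 1.
Proof.
move=> p0; have ep := enorm_gt0 p0.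
by rewrite enormZ ?invr_ge0 ?ltW // mulVf // gt_eqF.
Qed.

(** Homogeneity writes [G p] as [(enorm p)^-1] times a value on the sphere, whose oscillation is
    controlled by [om] and whose size by [om 2]. *)
Lemma weight_equicontinuous m (p0 : 'rV[R]_m) (om : R -> R) e : p0 != 0 -> 0 < e ->
  (forall e, 0 < e -> exists2 d, 0 < d & om d <= e) ->
  exists2 d, 0 < d & forall G p, weight_class om G -> `|p0 - p| < d ->
    `|G p0 - G p| <= e.
Proof.
move=> p00 e0 omS; have ep0 := enorm_gt0 p00.
(* [c] bounds [(enorm p)^-1] for [p] near [p0], and [b / 2] below bounds [G] on the sphere; each of
   the two error terms then takes half of [e]. *)
pose c := 2 * (enorm p0)^-1.
have iv0 : 0 < (enorm p0)^-1 by rewrite invr_gt0.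
have c0 : 0 < c by rewrite /c mulr_gt0.
have [d1 d10 omd1] : exists2 d, 0 < d & om d <= e / (2 * c).
  by apply: omS; rewrite divr_gt0 // mulr_gt0.
have cinv : (enorm p)^-1 @[p --> p0] --> (enorm p0)^-1.
  exact: (cvgV (lt0r_neq0 ep0) (@enorm_continuous m p0)).
have chat : ((enorm p)^-1 *: p) @[p --> p0] --> (enorm p0)^-1 *: p0.
  exact: (cvgZ cinv (@cvg_id _ (nbhs p0))).
pose b := 2 * (`|om 2| + 1).
have b0 : 0 < b by rewrite /b mulr_gt0 // ltr_wpDl.
have eb0 : 0 < e / b by rewrite divr_gt0.
have /nbhs_normP[d /= d0 dP] : \forall p \near p0, [/\ p != 0,
    `|(enorm p0)^-1 - (enorm p)^-1| < (enorm p0)^-1,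
    `|(enorm p0)^-1 - (enorm p)^-1| < e / b
  & `|(enorm p0)^-1 *: p0 - (enorm p)^-1 *: p| < d1].
  have /cvgrPdist_lt h := cinv; have /cvgrPdist_lt /(_ _ d10) h3 := chat.
  have {}h1 := h _ iv0; have {}h2 := h _ eb0.
  near=> p; split; [|by near: p..].
  rewrite -enorm_eq0 -invr_eq0; apply/eqP => i0.
  have : `|(enorm p0)^-1 - (enorm p)^-1| < (enorm p0)^-1 by near: p.
  by rewrite i0 subr0 gtr0_norm // ltxx.
exists d => // G p wG /dP[pn0 k1 k2 k3].
rewrite (weight_normalize wG p00) (weight_normalize wG pn0).
set q0 := _ *: p0 in k3 *; set q := _ *: p in k3 *.
set a0 := (enorm p0)^-1 in k1 k2 *; set a := (enorm p)^-1 in k1 k2 *.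
have -> : a0 *: G q0 - a *: G q = a *: (G q0 - G q) + (a0 - a) *: G q0.
  by apply/matrixP => i j; rewrite !mxE; ring.
have q01 : enorm q0 = 1 by exact: enorm_normalize.
have q1 : enorm q = 1 by exact: enorm_normalize.
have g1 : `|G q0 - G q| <= e / (2 * c).
  by apply: le_trans omd1; apply: weight_modulus => //; exact: ltW.
have g2 := weight_bound wG q01.
have a_gt0 : 0 < a by rewrite invr_gt0 enorm_gt0.
have ac : a <= c.
  by move: k1; rewrite ltr_distlC /c -/a0 => /andP[_]; lra.
rewrite (le_trans (ler_normD _ _)) // !normrZ gtr0_norm //.
have t1 : a * `|G q0 - G q| <= e / 2.
  apply: (@le_trans _ _ (c * (e / (2 * c)))); first by rewrite ler_pM // ltW.
  by rewrite mulr_half_cancel.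
have t2 : `|a0 - a| * `|G q0| <= e / 2.
  apply: (@le_trans _ _ (e / b * (b / 2))).
    rewrite ler_pM //; first exact: ltW.
    rewrite /b mulrC mulKf // (le_trans g2) // (le_trans (ler_norm _)) //.
    by rewrite lerDl.
  by rewrite mulrA divfK ?gt_eqF.
lra.
Unshelve. all: by end_near. Qed.

Lemma mxtrace_mul_bound n (A D : 'M[R]_n) : `|\tr (A *m D)| <= n%:R * (n%:R * (`|A| * `|D|)).
Proof.
have cst_sum (c : R) : \sum_(i < n) c = n%:R * c by rewrite sumr_const card_ord mulr_natl.
rewrite /mxtrace (le_trans (ler_norm_sum _ _ _)) // -cst_sum ler_sum // => i _.
rewrite mxE (le_trans (ler_norm_sum _ _ _)) // -cst_sum ler_sum // => j _.
by rewrite normrM ler_pM // ler_mxe.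
Qed.

Lemma norm_ulsubmx n (A : 'M[R]_(n + 1)) : `|ulsubmx A| <= `|A|.
Proof.
by apply: mx_norm_le => // i j; rewrite !mxE; exact: ler_mxe.
Qed.

(** In the application [s] is [L^-1], while [p] and [D] are the gradient (up to sign) and the
    Hessian of the barrier after division by [L]; [p0] and [D0] come from [rho] at a boundary
    point. *)
Lemma mxtrace_equicontinuous n (p0 : 'rV[R]_n) (D0 : 'M[R]_n) (om : R -> R) e :
  p0 != 0 -> 0 < e ->
  (forall e, 0 < e -> exists2 d, 0 < d & om d <= e) ->
  exists2 d, 0 < d & forall (G : 'rV[R]_(n + 1) -> 'M[R]_(n + 1)) p s D,
    weight_class om G -> `|p0 - p| < d -> `|s| < d -> `|D0 - D| < d ->
    `|\tr (wblock G p0 0 *m D0) - \tr (wblock G p s *m D)| <= e.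
Proof.
move=> p00 e0 omS; pose P0 : 'rV[R]_(n + 1) := row_mx p0 (0 : R)%:M.
have P00 : P0 != 0 by exact: row_mx_neq0l.
pose k : R := n%:R * n%:R + 1.
have k0 : 0 < k by rewrite /k ltr_wpDl // mulr_ge0.
pose b : R := (enorm P0)^-1 * `|om 2| + 1.
have b0 : 0 < b by rewrite /b ltr_wpDl // mulr_ge0 // invr_ge0 sqrtr_ge0.
pose e1 : R := e / (2 * (k * (`|D0| + 1))).
have e10 : 0 < e1 by rewrite /e1 divr_gt0 // !mulr_gt0 // ltr_wpDl.
have [d1 d10 d1P] := weight_equicontinuous P00 e10 omS.
pose e2 : R := e / (2 * (k * b)).
have e20 : 0 < e2 by rewrite /e2 divr_gt0 // !mulr_gt0.
exists (Num.min d1 (Num.min 1 e2)); first by rewrite !lt_min d10 ltr01 e20.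
move=> G p s D wG; rewrite !lt_min => /andP[pd1 _] /andP[sd1 _] /and3P[_ D1 De2].
have Pd : `|P0 - row_mx p s%:M| < d1.
  have d2 : `|P0 - row_mx p s%:M| <= Num.max `|p0 - p| `|s|.
    apply: mx_norm_le => [|i j]; first by rewrite le_max normr_ge0.
    rewrite -(fintype.splitK j); case: (fintype.split j) => l /=.
      rewrite [X in `|X|]mxE row_mxEl [X in _ + X]mxE row_mxEl le_max; apply/orP; left.
      by have := ler_mxe (p0 - p) i l; rewrite !mxE.
    rewrite [X in `|X|]mxE row_mxEr [X in _ + X]mxE row_mxEr !mxE !ord1 !eqxx !mulr1n.
    by rewrite sub0r normrN le_max lexx orbT.
  by apply: le_lt_trans d2 _; rewrite gt_max pd1 sd1.
have GP := d1P G _ wG Pd.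
set A0 := wblock G p0 0; set A := wblock G p s.
have AA : `|A0 - A| <= e1.
  apply: le_trans GP; apply: le_trans (norm_ulsubmx _).
  suff -> : ulsubmx (G P0 - G (row_mx p s%:M)) = A0 - A by [].
  by apply/matrixP => i j; rewrite /A0 /A /wblock !mxE.
have A0b : `|A0| <= b.
  apply: (le_trans (norm_ulsubmx _)); rewrite (weight_normalize wG P00) normrZ.
  rewrite ger0_norm ?invr_ge0 ?sqrtr_ge0 // /b.
  have : (enorm P0)^-1 * `|G ((enorm P0)^-1 *: P0)| <= (enorm P0)^-1 * `|om 2|.
    apply: ler_wpM2l; first by rewrite invr_ge0 sqrtr_ge0.
    by apply: le_trans (weight_bound wG (enorm_normalize P00)) _; exact: ler_norm.
  lra.
have -> : \tr (A0 *m D0) - \tr (A *m D) = \tr (A0 *m (D0 - D)) + \tr ((A0 - A) *m D).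
  by rewrite mulmxBr mulmxBl !linearB /=; ring.
have Db : `|D| <= `|D0| + 1.
  have -> : D = D0 - (D0 - D) by rewrite opprB addrC subrK.
  by rewrite (le_trans (ler_normB _ _)) // lerD2l ltW.
rewrite (le_trans (ler_normD _ _)) //.
have kb (A' D' : 'M[R]_n) x y : `|A'| <= x -> `|D'| <= y ->
    `|\tr (A' *m D')| <= k * (x * y).
  move=> A'x D'y; have xy : 0 <= `|A'| * `|D'| by rewrite mulr_ge0.
  have xy' : `|A'| * `|D'| <= x * y by rewrite ler_pM.
  have n0 : 0 <= n%:R :> R by [].
  apply: le_trans (mxtrace_mul_bound _ _) _; rewrite /k mulrA; nra.
have t1 : `|\tr (A0 *m (D0 - D))| <= e / 2.
  apply: le_trans (kb _ _ _ _ A0b (ltW De2)) _.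
  by rewrite mulrA /e2 mulr_half_cancel // mulr_gt0.
have t2 : `|\tr ((A0 - A) *m D)| <= e / 2.
  apply: le_trans (kb _ _ _ _ AA Db) _.
  rewrite [e1 * _]mulrC mulrA /e1 mulr_half_cancel // mulr_gt0 //.
lra.
Qed.

End moduli.

(** * The barrier *)

Section barrier.
Variable R : realType.

Lemma is_derive_affine (b c t : R) : is_derive t (1 : R) (fun s : R => b + s * c) c.
Proof.
have h1 := @is_derive_cst R R R b t 1; have h2 := @is_derive_id R R t 1.
have h3 := is_deriveD h1 (is_derive_mul h2 (@is_derive_cst R R R c t 1)).
apply: is_derive_eq h3 _; rewrite /= mulr0 add0r add0r; exact: mulr1.
Qed.

Lemma is_derive_quadratic (a b c t : R) :
  is_derive t (1 : R) (fun s : R => a + s * (b + s * c)) (b + 2 * t * c).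
Proof.
have h2 := is_derive_mul (@is_derive_id R R t 1) (is_derive_affine b c t).
apply: is_derive_eq (is_deriveD (@is_derive_cst R R R a t 1) h2) _.
by rewrite add0r /= [_ * 1]mulr1; ring.
Qed.

Lemma normr_sqr_le_dot n (x : 'rV[R]_n) : `|x| ^+ 2 <= dot x x.
Proof.
rewrite -[leRHS]sqr_sqrtr ?dot_ge0 // lerXn2r ?nnegrE ?sqrtr_ge0 //.
exact: norm_le_enorm.
Qed.

Lemma closed_ball_compact n (x : 'rV[R]_n) r : compact [set y | `|x - y| <= r].
Proof.
apply: bounded_closed_compact.
  exists (r + `|x|); split; first exact: num_real.
  move=> e er y /= xy.
  rewrite -[y](subrK x) (le_trans (ler_normD _ _)) // distrC.
  by apply: ltW; apply: le_lt_trans er; rewrite lerD2r.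
exact: (@closed_closed_ball_ R 'rV[R]_n x r).
Qed.

Lemma dotNr n (x z : 'rV[R]_n) : dot z (- x) = - dot z x.
Proof. by rewrite -scaleN1r dotZr mulN1r. Qed.

Lemma sign_expand (sg fu fp fr dy L k : R) : sg * sg = 1 ->
  sg * (fu + -1 * (fp + sg * (L * fr + k * dy))) = sg * (fu - fp) - (L * fr + k * dy).
Proof.
move=> sg2; transitivity (sg * (fu - fp) - (sg * sg) * (L * fr + k * dy)).
  by ring.
by rewrite sg2 mul1r.
Qed.

(* [sg = 1] is the upper barrier and [sg = - 1] the lower one. *)
Lemma barrier_comparison n (Omega B : set 'rV[R]_n) rho
    (G : 'rV[R]_(n + 1) -> 'M[R]_(n + 1)) (u Phi h : 'rV[R]_n -> R) x0
    (r L kappa M K sg : R) :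
  open Omega -> defining_function Omega B rho -> weight_matrix G ->
  sg * sg = 1 -> `|sg| = 1 -> 0 <= L -> 0 <= kappa -> M + K <= kappa * r ^+ 2 ->
  (forall y, `|x0 - y| <= r -> B y) ->
  Ck 2 Omega u -> {within closure Omega, continuous u} ->
  Ck 2 Omega Phi -> {within closure Omega, continuous Phi} ->
  (forall x, bdry Omega x -> u x = Phi x) ->
  (forall x, Omega x -> `|u x| <= M) -> (forall x, Omega x -> `|Phi x| <= K) ->
  (forall x, Omega x -> \tr (wblock G (- grad u x) 1 *m hess u x) = h x) ->
  (forall x, Omega x -> `|x0 - x| < r ->
     sg * \tr (wblock G (- (grad Phi x + sg *: (L *: grad rho x + (2 * kappa) *: (x - x0)))) 1
               *m (hess Phi x + sg *: (L *: hess rho x + (2 * kappa)%:M))) < sg * h x) ->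
  forall x, Omega x -> `|x0 - x| < r ->
    sg * (u x - Phi x) <= L * rho x + kappa * dot (x - x0) (x - x0).
Proof.
move=> oO [oB rhoC _ [rho_pos rho0] _] wG sg2 sg1 L0 k0 MK rB.
move=> uC cu PhiC cPhi bdE uM PhiK eqn str.
move=> x Ox xr; rewrite leNgt; apply/negP => xbad.
pose v y := sg * (u y - Phi y) - (L * rho y + kappa * dot (y - x0) (y - x0)).
pose A := closure Omega `&` [set y | `|x0 - y| <= r].
have cA : compact A.
  by rewrite /A setIC; apply: compact_closedI; [exact: closed_ball_compact|exact: closed_closure].
have Ax : A x by split; [exact: subset_closure|exact: ltW].
have cv : {within A, continuous v}.
  have cuA : {within A, continuous u} by apply: continuous_subspaceW cu => y [].
  have cPA : {within A, continuous Phi} by apply: continuous_subspaceW cPhi => y [].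
  have crA : {within A, continuous rho}.
    apply: continuous_in_subspaceT => y; rewrite inE => -[_ /= /rB By].
    by have [+ _] := rhoC; apply.
  have cqA : {within A, continuous (fun y => dot (y - x0) (y - x0))}.
    rewrite (_ : (fun y => _) = fun y : 'rV[R]_n =>
      \sum_i (y 0 i - x0 0 i) * (y 0 i - x0 0 i)); last first.
      by apply/funext => y; apply: eq_bigr => i _; rewrite !mxE.
    apply: continuous_subspaceT => y.
    apply: (@cvg_sum_ord R _ (nbhs y) _ n
      (fun i (y : 'rV[R]_n) => (y 0 i - x0 0 i) * (y 0 i - x0 0 i))
      (fun i => (y 0 i - x0 0 i) * (y 0 i - x0 0 i))) => i.
    have ci : (fun y : 'rV[R]_n => y 0 i - x0 0 i) @ y --> y 0 i - x0 0 i.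
      by apply: (@cvgB _ _ _ (nbhs y)); [exact: coord_continuous|exact: cvg_cst].
    exact: (cvgM ci ci).
  have cM (c : R) (f : 'rV[R]_n -> R) : {within A, continuous f} ->
      {within A, continuous (fun y => c * f y)}.
    by move=> cf y; apply: cvgMl_tmp; exact: cf.
  move=> y; apply: cvgB; first by apply: (cM sg); move=> z; apply: cvgB; [exact: cuA|exact: cPA].
  by apply: cvgD; [exact: (cM L _ crA)|exact: (cM kappa _ cqA)].
have [c] := compact_EVT_max (ex_intro _ x Ax) cA cv.
rewrite inE => -[clc /= cr] vmax.
have vc : 0 < v c.
  apply: (@lt_le_trans _ _ (v x)); first by rewrite subr_gt0.
  by apply: vmax; rewrite inE.
(* The maximum point [c] is not on the boundary of [Omega], where [u = Phi] and [rho = 0]. It is not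
   at distance [r] from [x0] either: there the quadratic term is at least [kappa * r ^+ 2], as the
   maximum norm is below the Euclidean one. *)
have [Oc|nOc] := pselect (Omega c); last first.
  have bdc : bdry Omega c by split => // /interior_subset.
  move: vc; rewrite /v bdE // subrr mulr0 (rho0 c (rB c cr) bdc) mulr0 !add0r.
  by rewrite oppr_gt0 ltNge mulr_ge0 ?dot_ge0.
have := cr; rewrite le_eqVlt => /orP[/eqP cr'|cr'].
  have h1 : sg * (u c - Phi c) <= M + K.
    apply: (le_trans (ler_norm _)); rewrite normrM sg1 mul1r.
    by apply: (le_trans (ler_normB _ _)); apply: lerD; [exact: uM|exact: PhiK].
  have h2 : kappa * r ^+ 2 <= kappa * dot (c - x0) (c - x0).
    apply: ler_wpM2l => //; apply: le_trans (normr_sqr_le_dot _).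
    by rewrite distrC cr'.
  have h3 : 0 <= L * rho c by rewrite mulr_ge0 // ltW // rho_pos //; exact: rB.
  by move: vc; rewrite /v; lra.
have [q qE] : exists q, q = c - x0 by exists (c - x0).
have nr : \forall y \near c, `|x0 - y| < r.
  have d1 : 0 < r - `|x0 - c| by rewrite subr_gt0.
  apply/nbhs_normP; exists (r - `|x0 - c|) => //= y cy.
  by rewrite -(subrKA c) (le_lt_trans (ler_normD _ _)) // addrC -ltrBrDr.
have nO : \forall y \near c, Omega y by exact: open_nbhs_nbhs.
have /nbhs_normP[d /= d0 dP] : \forall y \near c, Omega y /\ `|x0 - y| < r.
  by near=> y; split; near: y.
have BO y : Omega y /\ `|x0 - y| < r -> B y by move=> [_ /ltW /rB].
have test (y : 'rV[R]_n) :
    dot y (sg *: (grad u c - grad Phi c) - (L *: grad rho c + (2 * kappa) *: q)) = 0 /\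
    sg * (form (hess u c) y y - form (hess Phi c) y y) -
      (L * form (hess rho c) y y + 2 * kappa * dot y y) <= 0.
  pose e := d / (`|y| + 1).
  have y1 : 0 < `|y| + 1 by rewrite ltr_wpDl.
  have e0 : 0 < e by rewrite divr_gt0.
  have near (t : R) : `|t| < e -> Omega (c + t *: y) /\ `|x0 - (c + t *: y)| < r.
    move=> te; apply: dP; rewrite /= opprD addrA subrr sub0r normrN normrZ.
    apply: (@le_lt_trans _ _ (`|t| * (`|y| + 1))); first by rewrite ler_wpM2l // lerDl.
    by rewrite -ltr_pdivlMr.
  pose gv (z : 'rV[R]_n) := sg *: (grad u z - grad Phi z) - L *: grad rho z.
  pose f' (t : R) := sg * (dot y (grad u (c + t *: y)) - dot y (grad Phi (c + t *: y)))
    - (L * dot y (grad rho (c + t *: y)) + kappa * (2 * dot q y + 2 * t * dot y y)).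
  have df (t : R) : `|t| < e -> is_derive t (1 : R) (fun t : R => v (c + t *: y)) (f' t).
    move=> te; have [Ot rt] := near t te; have Bt := BO _ (conj Ot rt).
    have du := C1_line oO (C2_C1 uC) Ot; have dPhi := C1_line oO (C2_C1 PhiC) Ot.
    have drho := C1_line oB (C2_C1 rhoC) Bt.
    have dq : is_derive t (1 : R) (fun t : R => dot (c + t *: y - x0) (c + t *: y - x0))
        (2 * dot q y + 2 * t * dot y y).
      have := is_derive_quadratic (dot q q) (2 * dot q y) (dot y y) t.
      congr (is_derive _ _ _ _); apply/funext => s.
      have -> : c + s *: y - x0 = q + s *: y by rewrite qE addrAC.
      by rewrite !(dotDl, dotDr, dotZl, dotZr) (dotC y q); ring.
    exact: (is_deriveB (is_deriveZ sg (is_deriveB du dPhi))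
       (is_deriveD (is_deriveZ L drho) (is_deriveZ kappa dq))).
  have c0 : c + (0 : R) *: y = c by rewrite scale0r addr0.
  have df' : is_derive (0 : R) (1 : R) f' (sg * (form (hess u c) y y - form (hess Phi c) y y) -
      (L * form (hess rho c) y y + kappa * (2 * dot y y))).
    have du := C2_line y oO uC Oc; have dPhi := C2_line y oO PhiC Oc.
    have drho := C2_line y oB rhoC (rB c cr).
    have dq : is_derive (0 : R) (1 : R) (fun t : R => 2 * dot q y + 2 * t * dot y y) (2 * dot y y).
      have := is_derive_affine (2 * dot q y) (2 * dot y y) 0.
      by congr (is_derive _ _ _ _); apply/funext => s; ring.
    exact: (is_deriveB (is_deriveZ sg (is_deriveB du dPhi))
       (is_deriveD (is_deriveZ L drho) (is_deriveZ kappa dq))).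
  have fmax (t : R) : `|t| < e -> v (c + t *: y) <= v (c + (0 : R) *: y).
    move=> te; have [Ot rt] := near t te; rewrite c0; apply: vmax; rewrite inE.
    by split; [exact: subset_closure|exact: ltW].
  have [f'0 f''0] := second_derivative_max e0 df df' fmax.
  split; last by rewrite -mulrA mulrCA.
  rewrite -[RHS]f'0 /f' c0 !(dotDr, dotNr, dotZr) (dotC y q); ring.
(* The first order condition, tested in the direction of this very vector, makes it vanish: [u] and
   the barrier share their gradient at [c], and hence the matrix [A0]. *)
have g0 : sg *: (grad u c - grad Phi c) - (L *: grad rho c + (2 * kappa) *: q) = 0.
  apply/eqP; rewrite -dot_eq0; apply/eqP.
  by have [+ _] := test (sg *: (grad u c - grad Phi c) -
    (L *: grad rho c + (2 * kappa) *: q)); exact.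
have gE : grad Phi c + sg *: (L *: grad rho c + (2 * kappa) *: q) = grad u c.
  by move/eqP : g0; rewrite subr_eq0 => /eqP <-; rewrite scalerA sg2 scale1r addrC subrK.
have := str c Oc cr'; rewrite -qE gE -(eqn c Oc) ltNge => /negP; apply.
have P0 := row_mx_neq0r (- grad u c) (oner_neq0 R).
set A0 := wblock _ _ _.
have pA y : 0 <= form A0 y y.
  by rewrite /A0 /wblock form_ulsubmx; exact: (weight_psd _ wG P0).
have sA : A0^T = A0.
  have [sG _ _ _] := wG.
  by rewrite /A0 /wblock trmx_ulsub sG.
pose D := sg *: (hess u c - (hess Phi c + sg *: (L *: hess rho c + (2 * kappa)%:M))).
have nD y : form D y y <= 0.
  have [_] := test y; apply: le_trans.
  have fD (A1 A2 : 'M[R]_n) : form (A1 + A2) y y = form A1 y y + form A2 y y.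
    by rewrite /form mulmxDr mulmxDl mxE.
  have fZ (a : R) (A1 : 'M[R]_n) : form (a *: A1) y y = a * form A1 y y.
    by rewrite /form -scalemxAr -scalemxAl mxE.
  have f1 (a : R) : form (a%:M) y y = a * dot y y.
    by rewrite -scalemx1 fZ form_dot mulmx1.
  rewrite /D -scaleN1r !(fD, fZ) f1.
  by rewrite (sign_expand _ _ _ _ _ _ sg2).
have := mxtrace_psd_nsd sA pA nD.
by rewrite /D -scalemxAr mxtraceZ mulmxBr linearB /= mulrBr subr_le0.
Unshelve. all: by end_near. Qed.

End barrier.

(** * The gradient on the boundary *)

Section boundary_gradient.
Variable R : realType.

(** The continuous extension shows that the [lim] in [bgrad] is an actual limit rather than a
    default value. *)
Lemma C0_ext_lim n (Omega : set 'rV[R]_n) (f : 'rV[R]_n -> R) x :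
  closure Omega x -> C0_ext Omega f ->
  forall e, 0 < e -> exists2 r : R, 0 < r & forall y, Omega y -> `|x - y| < r ->
    `|lim (f y @[y --> within Omega (nbhs x)]) - f y| < e.
Proof.
move=> clx [g [cg gf]].
have gx e : 0 < e -> exists2 r : R, 0 < r & forall y, Omega y -> `|x - y| < r ->
    `|g x - f y| < e.
  move=> e0; have [r r0 rP] := within_continuous_dist cg clx e0.
  by exists r => // y Oy xy; rewrite -gf //; apply: rP => //; exact: subset_closure.
have PF : ProperFilter (within Omega (nbhs x)) by exact: within_nbhs_proper.
suff -> : lim (f y @[y --> within Omega (nbhs x)]) = g x by [].
apply: cvg_lim => //; apply/cvgrPdist_lt => e e0.
have [r r0 rP] := gx e e0.
have h : \forall y \near x, Omega y -> `|g x - f y| < e.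
  by apply/nbhs_normP; exists r => // y xy Oy; exact: rP.
by rewrite near_withinE.
Qed.

Lemma ray_continuous n (A : set 'rV[R]_n) (f : 'rV[R]_n -> R) (x y : 'rV[R]_n) (t : R) :
  {within A, continuous f} -> (forall s, 0 <= s <= t -> A (x + s *: y)) ->
  {within `[0, t], continuous (fun s : R => f (x + s *: y))}.
Proof.
move=> cf At; apply/subspace_continuousP => s; rewrite /= in_itv /= => st.
apply/cvgrPdist_lt => e e0.
have [r r0 rP] := within_continuous_dist cf (At s st) e0.
have y1 : 0 < `|y| + 1 by rewrite ltr_wpDl.
suff h : \forall s' \near s, `[0, t]%classic s' ->
    `|f (x + s *: y) - f (x + s' *: y)| < e by rewrite near_withinE.
apply/nbhs_normP; exists (r / (`|y| + 1)) => /=; first by rewrite divr_gt0.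
move=> s' ss'; rewrite in_itv /= => s't; apply: rP; first exact: At.
rewrite opprD addrACA subrr add0r -scalerBl normrZ.
apply: (@le_lt_trans _ _ (`|s - s'| * (`|y| + 1))); first by rewrite ler_wpM2l // lerDl.
by rewrite -ltr_pdivlMr.
Qed.

Lemma near_right_all (Q : R -> Prop) : (\forall s \near (0 : R)^'+, Q s) ->
  \forall t \near (0 : R)^'+, forall s, 0 < s <= t -> Q s.
Proof.
move=> [r /= r0 rP]; exists r => //= t; rewrite /ball_ /= sub0r normrN => tr t0 s /andP[s0 st].
apply: rP => //=; rewrite /ball_ /= sub0r normrN gtr0_norm //.
by apply: le_lt_trans tr; rewrite gtr0_norm.
Qed.

Lemma near_right_ball n (x y : 'rV[R]_n) (r : R) : 0 < r ->
  \forall t \near (0 : R)^'+, `|x - (x + t *: y)| < r.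
Proof.
move=> r0; have y1 : 0 < `|y| + 1 by rewrite ltr_wpDl.
have : \forall t \near (0 : R)^'+, t < r / (`|y| + 1).
  by apply: nbhs_right_lt; rewrite divr_gt0.
move=> h; near=> t; rewrite opprD addrA subrr sub0r normrN normrZ.
have t0 : 0 < t by near: t; exact: nbhs_right_gt.
rewrite gtr0_norm //; apply: (@le_lt_trans _ _ (t * (`|y| + 1))).
  by rewrite ler_wpM2l // ?lerDl // ltW.
by rewrite -ltr_pdivlMr //; near: t.
Unshelve. all: by end_near. Qed.

Definition bgrad_diff n (Omega : set 'rV[R]_n) (u Phi : 'rV[R]_n -> R) x : 'rV[R]_n :=
  bgrad Omega u x - bgrad Omega Phi x.

Lemma dot_bound n (x y : 'rV[R]_n) c : (forall i, `|y 0 i| <= c) ->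
  `|dot x y| <= n%:R * (`|x| * c).
Proof.
move=> yc; rewrite /dot (le_trans (ler_norm_sum _ _ _)) //.
apply: (@le_trans _ _ (\sum_(i < n) `|x| * c)).
  by apply: ler_sum => i _; rewrite normrM ler_pM // ler_mxe.
by rewrite sumr_const card_ord mulr_natl.
Qed.

(** Gradients are known inside [Omega] only. The mean value theorem on a short ray gives an interior
    point where the derivative of [u - Phi] obeys the barrier bound, and gradients converge to
    [bgrad] as the ray shrinks. The quadratic term is of second order along the ray and
    disappears. *)
Lemma bgrad_diff_inward n (Omega B : set 'rV[R]_n) rho (u Phi : 'rV[R]_n -> R) x0
    (r L kappa : R) y :
  open Omega -> defining_function Omega B rho -> B x0 -> bdry Omega x0 ->
  C2_closure Omega u -> C2_closure Omega Phi ->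
  (forall x, bdry Omega x -> u x = Phi x) ->
  0 < r -> 0 <= L -> 0 <= kappa ->
  (forall x, Omega x -> `|x0 - x| < r ->
     `|u x - Phi x| <= L * rho x + kappa * dot (x - x0) (x - x0)) ->
  0 < dot y (grad rho x0) ->
  `|dot y (bgrad_diff Omega u Phi x0)| <= L * dot y (grad rho x0).
Proof.
move=> oO [oB rhoC _ [_ rho0] inw] Bx bdx [uC cu u1 _] [PhiC cPhi Phi1 _] uPhi r0 L0 k0 bar dy.
have [clx _] := bdry_open oO bdx.
apply/ler_addgt0Pr => e e0.
(* [c] collects the errors in units of [e1]: [L] from the slope of [rho], 1 from the quadratic term,
   the rest from the gradients of [u] and [Phi]. *)
pose c := L + 1 + n%:R * (`|y| * 2).
have c0 : 0 < c by rewrite /c ltr_wpDr // ?mulr_ge0 // ltr_wpDl.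
pose e1 := e / c; have e10 : 0 < e1 by rewrite divr_gt0.
have n1 := near_right_all (inw x0 y Bx bdx dy).
have n2 := near_right_ball x0 y r0.
have n3 : \forall t \near (0 : R)^'+, rho (x0 + t *: y) <= t * (dot y (grad rho x0) + e1).
  have lin := @C1_line R n B rho x0 y 0 oB (C2_C1 rhoC).
  rewrite scale0r addr0 in lin; have {}lin := lin Bx.
  have lin2 := is_deriveB (is_derive_affine 0 (dot y (grad rho x0) + e1) 0) lin.
  have pos : 0 < dot y (grad rho x0) + e1 - dot y (grad rho x0) by rewrite addrC addKr.
  have := derive_gt0_right lin2 pos.
  apply: filterS => t; rewrite !fctE scale0r !addr0 mul0r add0r rho0 // subr0 add0r.
  by rewrite subr_gt0 => /ltW.
have n4 : \forall t \near (0 : R)^'+, kappa * (t * dot y y) <= e1.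
  have k1 : 0 < kappa * dot y y + 1 by rewrite ltr_wpDl // mulr_ge0 // dot_ge0.
  have : \forall t \near (0 : R)^'+, t < e1 / (kappa * dot y y + 1).
    by apply: nbhs_right_lt; rewrite divr_gt0.
  move=> h; near=> t; have t0 : 0 < t by near: t; exact: nbhs_right_gt.
  apply: (@le_trans _ _ (t * (kappa * dot y y + 1))).
    by rewrite mulrCA ler_wpM2l ?lerDl // ltW.
  by rewrite -ler_pdivlMr // ltW //; near: t.
(* The mean value theorem does not locate its point, so the gradient must be close for every [s] up
   to [t]. *)
have n5 (f : 'rV[R]_n -> R) : (forall i, C0_ext Omega (pd i f)) ->
    \forall t \near (0 : R)^'+, forall s, 0 < s <= t -> Omega (x0 + s *: y) ->
      forall i, `|bgrad Omega f x0 0 i - pd i f (x0 + s *: y)| < e1.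
  move=> f1; apply: near_right_all.
  suff : \forall t \near (0 : R)^'+, forall i, Omega (x0 + t *: y) ->
      `|bgrad Omega f x0 0 i - pd i f (x0 + t *: y)| < e1.
    by apply: filterS => t h Ot i; exact: h.
  apply: (@filter_forall _ _ (fun i t => Omega (x0 + t *: y) ->
      `|bgrad Omega f x0 0 i - pd i f (x0 + t *: y)| < e1)) => i.
  have [d d0 dP] := C0_ext_lim clx (f1 i) e10.
  have := near_right_ball x0 y d0; apply: filterS => t td Ot.
  by rewrite mxE; exact: dP.
have n6 := n5 u u1; have n7 := n5 Phi Phi1.
have main : \forall t \near (0 : R)^'+,
    `|dot y (bgrad_diff Omega u Phi x0)| <= L * dot y (grad rho x0) + e.
  near=> t; have t0 : 0 < t by near: t; exact: nbhs_right_gt.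
  have tO s : 0 < s <= t -> Omega (x0 + s *: y) by move: s; near: t.
  have tcl s : 0 <= s <= t -> closure Omega (x0 + s *: y).
    move=> /andP[s0 st]; have [->|sn0] := eqVneq s 0; first by rewrite scale0r addr0.
    by apply: subset_closure; apply: tO; rewrite st andbT lt_neqAle eq_sym sn0.
  pose F (s : R) := u (x0 + s *: y) - Phi (x0 + s *: y).
  pose F' (s : R) := dot y (grad u (x0 + s *: y)) - dot y (grad Phi (x0 + s *: y)).
  have [| |s] := @MVT R F F' 0 t t0.
  - move=> s; rewrite in_itv /= => /andP[s0 st].
    have Os : Omega (x0 + s *: y) by apply: tO; rewrite s0 ltW.
    exact: (is_deriveB (C1_line oO (C2_C1 uC) Os) (C1_line oO (C2_C1 PhiC) Os)).
  - move=> s; apply: cvgB; [exact: (ray_continuous cu tcl)|exact: (ray_continuous cPhi tcl)].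
  rewrite in_itv /= => /andP[s0 st] FE.
  have st' : 0 < s <= t by rewrite s0 ltW.
  have Os := tO s st'.
  have F0 : F 0 = 0 by rewrite /F scale0r addr0 uPhi // subrr.
  have Ft : `|F t| <= t * (L * (dot y (grad rho x0) + e1) + e1).
    have Ot : Omega (x0 + t *: y) by apply: tO; rewrite t0 lexx.
    have tr : `|x0 - (x0 + t *: y)| < r by near: t.
    apply: le_trans (bar _ Ot tr) _.
    have -> : x0 + t *: y - x0 = t *: y by rewrite addrC addKr.
    rewrite dotZl dotZr mulrDr; apply: lerD.
      by rewrite mulrCA ler_wpM2l //; near: t.
    by rewrite mulrCA ler_wpM2l ?(ltW t0) //; near: t.
  have F'b : `|F' s| <= L * (dot y (grad rho x0) + e1) + e1.
    move: FE; rewrite F0 !subr0 => FE.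
    by move: Ft; rewrite FE normrM (gtr0_norm t0) mulrC ler_pM2l.
  have hu : forall s, 0 < s <= t -> Omega (x0 + s *: y) ->
      forall i, `|bgrad Omega u x0 0 i - pd i u (x0 + s *: y)| < e1 by near: t.
  have hP : forall s, 0 < s <= t -> Omega (x0 + s *: y) ->
      forall i, `|bgrad Omega Phi x0 0 i - pd i Phi (x0 + s *: y)| < e1 by near: t.
  have dif : `|dot y (bgrad_diff Omega u Phi x0 - (grad u (x0 + s *: y) - grad Phi (x0 + s *: y)))|
      <= n%:R * (`|y| * (2 * e1)).
    apply: dot_bound => i.
    have := hu s st' Os i; have := hP s st' Os i; rewrite /bgrad_diff.
    move: (bgrad Omega u x0) (bgrad Omega Phi x0) => b1 b2.
    rewrite !mxE.
    move: (pd i u _) (pd i Phi _) (b1 0 i) (b2 0 i) => p1 p2 q1 q2 h2 h1.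
    have -> : q1 - q2 - (p1 - p2) = (q1 - p1) - (q2 - p2) by ring.
    apply: le_trans (ler_normB _ _) _; lra.
  have -> : dot y (bgrad_diff Omega u Phi x0) =
     dot y (bgrad_diff Omega u Phi x0 - (grad u (x0 + s *: y) - grad Phi (x0 + s *: y))) + F' s.
    have F'E : F' s = dot y (grad u (x0 + s *: y) - grad Phi (x0 + s *: y)).
    by rewrite dotDr dotNr.
  by rewrite F'E -dotDr subrK.
  apply: le_trans (ler_normD _ _) _; apply: le_trans (lerD dif F'b) _.
  have ce : c * e1 = e by rewrite /e1 mulrC divfK // gt_eqF.
  rewrite -ce /c; move: (n%:R : R) (dot y _) (`|y|) => N Dy Ny; nra.
by have [t] := filter_ex main.
Unshelve. all: by end_near. Qed.

Lemma bgrad_le n (Omega : set 'rV[R]_n) (f : 'rV[R]_n -> R) x K k :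
  closure Omega x -> C0_ext Omega (pd k f) -> (forall y, Omega y -> `|pd k f y| <= K) ->
  `|bgrad Omega f x 0 k| <= K.
Proof.
move=> clx fk fK; apply/ler_addgt0Pr => e e0.
have [r r0 rP] := C0_ext_lim clx fk e0.
have [y [Oy xy]] : Omega `&` [set y | `|x - y| < r] !=set0.
  have h : \forall y \near x, `|x - y| < r by apply/nbhs_normP; exists r.
  exact: (clx _ h).
have := rP y Oy xy; rewrite mxE; set l := lim _ => lf.
have := fK y Oy => fy.
have -> : l = (l - pd k f y) + pd k f y by rewrite subrK.
by apply: le_trans (ler_normD _ _) _; rewrite addrC; apply: lerD => //; exact: ltW.
Qed.

Lemma bgrad_bound n (Omega B : set 'rV[R]_n) rho (u Phi : 'rV[R]_n -> R) x0 (r L kappa K : R) k :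
  open Omega -> defining_function Omega B rho -> B x0 -> bdry Omega x0 ->
  C2_closure Omega u -> C2_closure Omega Phi ->
  (forall x, bdry Omega x -> u x = Phi x) ->
  0 < r -> 0 <= L -> 0 <= kappa ->
  (forall x, Omega x -> `|x0 - x| < r ->
     `|u x - Phi x| <= L * rho x + kappa * dot (x - x0) (x - x0)) ->
  (forall y, Omega y -> `|pd k Phi y| <= K) ->
  `|bgrad Omega u x0 0 k| <= L * (3 * `|grad rho x0| + 2) + K.
Proof.
move=> oO rhoD Bx bdx uC PhiC uPhi r0 L0 k0 bar PhiK.
have inward y := @bgrad_diff_inward n Omega B rho u Phi x0 r L kappa y oO rhoD Bx bdx
  uC PhiC uPhi r0 L0 k0 bar.
have [clx _] := bdry_open oO bdx.
have Phik : `|bgrad Omega Phi x0 0 k| <= K.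
  by apply: bgrad_le => //; have [_ _ + _] := PhiC; exact.
have nu0 : grad rho x0 != 0 by have [_ _ + _ _] := rhoD; exact.
set nu := grad rho x0 in inward nu0 *; set g := bgrad_diff Omega u Phi x0 in inward.
have nn := dot_gt0 nu0.
have a_nu : `|nu 0 k| <= `|nu| by exact: ler_mxe.
(* [delta_mx 0 k] may be tangential or point outwards; adding [s *: nu] makes it
   point inwards. *)
pose s := (`|nu 0 k| + 1) / dot nu nu.
have s0 : 0 < s by rewrite divr_gt0 // ltr_wpDl.
have sE : s * dot nu nu = `|nu 0 k| + 1 by rewrite /s divfK // gt_eqF.
have i1 : `|dot nu g| <= L * dot nu nu by exact: inward.
have i2 : `|dot (delta_mx 0 k + s *: nu) g| <= L * (nu 0 k + s * dot nu nu).
  have E : dot (delta_mx 0 k + s *: nu) nu = nu 0 k + s * dot nu nu.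
    by rewrite dotDl dotZl dot_delta.
  rewrite -E; apply: inward; rewrite E sE.
  have := ler_norm (- nu 0 k); rewrite normrN; lra.
(* The numbers 3 and 2 arise by adding the bounds [2 * |nu 0 k| + 1] and [|nu 0 k| + 1], in units of
   [L], for the two inward directions. *)
have gk : `|g 0 k| <= L * (3 * `|nu| + 2).
  have -> : g 0 k = dot (delta_mx 0 k + s *: nu) g - s * dot nu g.
    by rewrite dotDl dotZl dot_delta addrK.
  apply: le_trans (ler_normB _ _) _; rewrite normrM (gtr0_norm s0).
  have i3 : s * `|dot nu g| <= L * (`|nu 0 k| + 1).
    by rewrite -sE mulrCA ler_wpM2l // ltW.
  have i4 : L * (nu 0 k + s * dot nu nu) <= L * (2 * `|nu 0 k| + 1).
    by rewrite ler_wpM2l // sE; have := ler_norm (nu 0 k); lra.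
  have i5 : L * (3 * `|nu 0 k| + 2) <= L * (3 * `|nu| + 2).
    by rewrite ler_wpM2l //; lra.
  lra.
have -> : bgrad Omega u x0 0 k = g 0 k + bgrad Omega Phi x0 0 k.
  by rewrite /g /bgrad_diff; move: (bgrad _ u _) (bgrad _ Phi _) => b1 b2; rewrite !mxE subrK.
by apply: le_trans (ler_normD _ _) _; exact: lerD.
Qed.

Lemma enorm_le_coord n (x : 'rV[R]_n) b : (forall i, `|x 0 i| <= b) ->
  enorm x <= Num.sqrt (n%:R * b ^+ 2).
Proof.
move=> xb; rewrite /enorm ler_wsqrtr // /dot.
apply: (@le_trans _ _ (\sum_(i < n) b ^+ 2)); last by rewrite sumr_const card_ord mulr_natl.
apply: ler_sum => i _; rewrite -expr2 -real_normK ?num_real // lerXn2r ?nnegrE //.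
exact: le_trans (normr_ge0 _) (xb i).
Qed.

End boundary_gradient.

(** * Admissible data *)

Section data.
Variable R : realType.

Lemma closure_compact n (Omega : set 'rV[R]_n) :
  bounded_set Omega -> compact (closure Omega).
Proof.
move=> [b [_ bP]]; apply: (subclosed_compact (@closed_closure _ Omega)
  (@closed_ball_compact R n 0 (b + 1))).
have cB : closed [set y : 'rV[R]_n | `|0 - y| <= b + 1].
  exact: (@closed_closed_ball_ R 'rV[R]_n 0 (b + 1)).
rewrite [X in _ `<=` X]((closure_id _).1 cB); apply: closure_subset => y Oy.
by rewrite /= sub0r normrN; apply: (bP (b + 1)); rewrite ?ltrDl.
Qed.

Lemma bdry_compact n (Omega : set 'rV[R]_n) : open Omega ->
  bounded_set Omega -> compact (bdry Omega).
Proof.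
move=> oO bO; rewrite /bdry setDE; apply: compact_closedI; first exact: closure_compact.
by apply: open_closedC; exact: open_interior.
Qed.

Definition slab n (A : set 'rV[R]_n) (M : R) : set ('rV[R]_n * R) :=
  [set p | A p.1 /\ `|p.2| <= M].

(** Here [a] is [H_minus], [- b] is [H_plus] and [h] the right-hand side, at two nearby points. Each
    difference involves two of them, so a margin [m] shrinks at most to [m / 2]. *)
Lemma margin_perturb (m a1 a2 b1 b2 h1 h2 e : R) :
  m <= - b1 - h1 -> m <= h1 - a1 -> `|a1 - a2| <= m / 4 -> `|b1 - b2| <= m / 4 ->
  `|h1 - h2| < m / 4 -> e < m / 4 -> (e <= - b2 - h2) && (e <= h2 - a2).
Proof.
rewrite !ler_distl ltr_distl => ? ? /andP[? ?] /andP[? ?] /andP[? ?] ?.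
by apply/andP; split; lra.
Qed.

Lemma slab_compact n (A : set 'rV[R]_n) (M : R) : compact A -> compact (slab A M).
Proof.
move=> cA; have -> : slab A M = A `*` `[- M, M].
  by apply/seteqP; split => -[x z]; rewrite /slab /= in_itv /= ler_norml.
exact: (compact_setX cA (@segment_compact _ (- M) M)).
Qed.

Definition admissible n (Omega : set 'rV[R]_n)
    (G : 'rV[R]_(n + 1) -> 'M[R]_(n + 1)) (H : 'rV[R]_n * R -> R)
    (phi u : 'rV[R]_n -> R) (M : R) : Prop :=
  [/\ weight_matrix G, (forall p, p != 0 -> {for p, continuous G}),
      {within closure Omega `*` [set: R], continuous H},
      C2_closure Omega u & prescribed_wmc_graph G Omega H u] /\
  [/\ C2_bdry Omega phi, (forall x, bdry Omega x -> u x = phi x),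
      (forall x, Omega x -> `|u x| <= M),
      (forall x, bdry Omega x -> 0 < H_plus G Omega x /\ H_minus G Omega x < 0)
    & (forall x z, bdry Omega x -> `|z| <= M ->
       H_minus G Omega x < H (x, z) < H_plus G Omega x)].

(** This is the rescaled limit of the barrier operator. Given by one [rho] on a neighborhood, it is
    visibly continuous in [x], unlike the pointwise chosen [H_minus] and [H_plus] that it represents
    on the boundary. *)
Definition curv n (G : 'rV[R]_(n + 1) -> 'M[R]_(n + 1)) (rho : 'rV[R]_n -> R)
    (sg : R) (x : 'rV[R]_n) : R :=
  \tr (wblock G (- (sg *: grad rho x)) 0 *m hess rho x).

(** * Curvature, margin and moduli of fixed admissible data *)

Section fixed_data.
Variables (n : nat) (Omega : set 'rV[R]_n).
Hypotheses (bO : bounded_set Omega) (C2O : C2_domain Omega).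
Variables (G : 'rV[R]_(n + 1) -> 'M[R]_(n + 1)) (H : 'rV[R]_n * R -> R)
    (phi u : 'rV[R]_n -> R) (M : R).
Hypothesis adm : admissible Omega G H phi u M.

Let oO : open Omega. Proof. by have [] := C2O. Qed.
Let wG : weight_matrix G. Proof. by have [[]] := adm. Qed.

Lemma curvE B rho x : defining_function Omega B rho -> B x -> bdry Omega x ->
  H_minus G Omega x = curv G rho 1 x /\ H_plus G Omega x = - curv G rho (- 1) x.
Proof.
move=> rhoD Bx bdx; have [_ [_ _ _ /(_ x bdx)[Hp Hm] _]] := adm.
split; rewrite /curv; first by rewrite scale1r; apply: (H_minusE oO wG rhoD) => //; rewrite lt_eqF.
by rewrite scaleN1r opprK; apply: (H_plusE oO wG rhoD) => //; rewrite gt_eqF.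
Qed.

Lemma height_ge0 : 0 <= M.
Proof.
have [_ _ [x Ox] _] := C2O; have [_ [_ _ uM _ _]] := adm.
exact: le_trans (normr_ge0 _) (uM x Ox).
Qed.

Definition margin (p : 'rV[R]_n * R) : R :=
  Num.min (H_plus G Omega p.1 - H p) (H p - H_minus G Omega p.1).

Lemma margin_gt0 p : slab (bdry Omega) M p -> 0 < margin p.
Proof.
move: p => [x z] [/= bdx zM]; have [_ [_ _ _ _ /(_ x z bdx zM)/andP[h1 h2]]] := adm.
by rewrite /margin /= lt_min !subr_gt0 h1 h2.
Qed.

Lemma curvature_gap_le p : slab (bdry Omega) M p -> curvature_gap G Omega M H <= margin p.
Proof.
move=> [bdp pM]; apply: ge_inf; last by exists p.1, p.2; split => //; case: p bdp pM.
by exists 0 => _ [x [z [bdx zM ->]]]; apply/ltW/(@margin_gt0 (x, z)).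
Qed.

(** Both halves of the margin in one formula, so that the upper and the lower barrier share one
    argument. *)
Lemma curvature_gap_curv B rho x z sg : defining_function Omega B rho -> B x ->
  bdry Omega x -> `|z| <= M -> sg = 1 \/ sg = - 1 ->
  curv G rho sg x + curvature_gap G Omega M H <= sg * H (x, z).
Proof.
move=> rhoD Bx bdx zM sgE; have [Em Ep] := curvE rhoD Bx bdx.
have := @curvature_gap_le (x, z) (conj bdx zM).
by rewrite /margin /= le_min Em Ep => /andP[h1 h2]; case: sgE => ->; lra.
Qed.

Lemma modulus_weight_small e : 0 < e -> exists2 d, 0 < d & modulus_weight G d <= e.
Proof.
move=> e0; apply: modulus_small => //; first exact: sphere_compact.
apply: (@weight_within_continuous _ _ (modulus_weight G)).
by split => //; have [[]] := adm.
Qed.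

Lemma rhs_within_continuous : {within slab (closure Omega) M, continuous H}.
Proof.
have [[_ _ cH _ _] _] := adm.
by apply: continuous_subspaceW cH => -[x z] [].
Qed.

Lemma modulus_rhs_small e : 0 < e -> exists2 d, 0 < d & modulus_rhs Omega M H d <= e.
Proof.
move=> e0; have cc := @slab_compact n _ M (closure_compact bO).
exact: (@modulus_small R ('rV[R]_n * R)%type R _ H e cc rhs_within_continuous e0).
Qed.

Lemma modulus_rhs_ge x y z t : closure Omega x -> closure Omega y -> `|z| <= M ->
  `|x - y| <= t -> `|H (x, z) - H (y, z)| <= modulus_rhs Omega M H t.
Proof.
move=> cx cy zM xy; have cc := @slab_compact n _ M (closure_compact bO).
apply: (@modulus_ge R ('rV[R]_n * R)%type R _ H t (x, z) (y, z) cc rhs_within_continuous) => //.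
by rewrite [leLHS]prod_normE /= subrr normr0 ge_max xy (le_trans (normr_ge0 _) xy).
Qed.

Lemma grad_cvg B rho z e : defining_function Omega B rho -> B z -> 0 < e ->
  \forall x \near z, `|grad rho z - grad rho x| < e /\ `|hess rho z - hess rho x| < e.
Proof.
move=> [oB rhoC _ _ _] Bz e0; have e2 : 0 < e / 2 by rewrite divr_gt0.
have h1 : \forall x \near z, forall i, `|pd i rho z - pd i rho x| < e / 2.
  apply: (@filter_forall _ _ (fun i x => `|pd i rho z - pd i rho x| < e / 2)
    (nbhs z) (nbhs_filter z)) => i.
  have [_ /(_ i)[_ [+ _]]] := rhoC => /(_ z Bz).
  by move=> /cvgrPdist_lt /(_ _ e2).
have h2 : \forall x \near z, forall ij : 'I_n * 'I_n,
    `|pd ij.2 (pd ij.1 rho) z - pd ij.2 (pd ij.1 rho) x| < e / 2.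
  apply: (@filter_forall _ _
    (fun ij x => `|pd ij.2 (pd ij.1 rho) z - pd ij.2 (pd ij.1 rho) x| < e / 2)
    (nbhs z) (nbhs_filter z)) => -[i j] /=.
  have [_ /(_ i)[_ [_ /(_ j)[_ [+ _]]]]] := rhoC => /(_ z Bz).
  by move=> /cvgrPdist_lt /(_ _ e2).
near=> x; split.
  apply: le_lt_trans (half_lt e0); apply: mx_norm_le => [|i j]; first exact: ltW.
  by rewrite !mxE; apply: ltW; move: j; near: x.
apply: le_lt_trans (half_lt e0); apply: mx_norm_le => [|i j]; first exact: ltW.
rewrite !mxE; apply: ltW.
have : forall ij : 'I_n * 'I_n,
    `|pd ij.2 (pd ij.1 rho) z - pd ij.2 (pd ij.1 rho) x| < e / 2 by near: x.
by move=> /(_ (i, j)).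
Unshelve. all: by end_near. Qed.

Lemma sign_neq0 (sg : R) m (p : 'rV[R]_m) : sg = 1 \/ sg = - 1 -> p != 0 -> - (sg *: p) != 0.
Proof.
by move=> sgE p0; rewrite oppr_eq0 scaler_eq0 negb_or p0 andbT; case: sgE => ->;
  rewrite ?oppr_eq0 oner_neq0.
Qed.

Lemma sign_norm (sg : R) : sg = 1 \/ sg = - 1 -> `|sg| = 1.
Proof. by case=> ->; rewrite ?normrN normr1. Qed.

Lemma curv_near B rho z sg e : defining_function Omega B rho -> B z ->
  sg = 1 \/ sg = - 1 -> 0 < e ->
  \forall x \near z, `|curv G rho sg z - curv G rho sg x| <= e.
Proof.
move=> rhoD Bz sgE e0; have [_ _ /(_ z Bz) g0 _ _] := rhoD.
have [d d0 dP] := mxtrace_equicontinuous (hess rho z) (sign_neq0 sgE g0) e0 modulus_weight_small.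
have := grad_cvg rhoD Bz d0; apply: filterS => x [gx hx].
apply: dP => //; last by rewrite normr0.
  by split => //; have [[]] := adm.
by rewrite -opprD normrN -scalerN -scalerDr normrZ sign_norm // mul1r.
Qed.

(** Near each point of the compact slab the margin is expressed by [curv] of a single defining
    function and by [H], so it keeps a positive lower bound there; near covering makes this bound
    global. *)
Lemma curvature_gap_gt0 x : bdry Omega x -> 0 < curvature_gap G Omega M H.
Proof.
move=> bdx.
have cA : compact (slab (bdry Omega) M) by apply: slab_compact; exact: bdry_compact.
have /near_covering_withinP cov := (compact_near_coveringP _).1 cA.
have := cov R (0 : R)^'+ (fun e p => e <= margin p).
case.
- move=> [z zeta] zA; have [/= bdz zM] := zA.
  have m0 := margin_gt0 zA; set m := margin _ in m0.
  have m4 : 0 < m / 4 by rewrite divr_gt0.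
  have [B [rho [Bz rhoD]]] := C2_domain_defining_function C2O bdz.
  have [_ _ cH _ _] := adm.1.
  have [clz _] := bdry_open oO bdz.
  have clzz : (closure Omega `*` [set: R]) (z, zeta) by split.
  have [r r0 rP] := within_continuous_dist cH clzz m4.
  have n1 := curv_near rhoD Bz (or_introl erefl) m4.
  have n2 := curv_near rhoD Bz (or_intror erefl) m4.
  have oB : open B by have [] := rhoD.
  have n3 : \forall x \near z, B x by exact: open_nbhs_nbhs.
  have n4 : \forall x \near z, `|z - x| < r by apply/nbhs_normP; exists r.
  have n5 : \forall s \near zeta, `|zeta - s| < r by apply/nbhs_normP; exists r.
  have n6 : \forall e \near (0 : R)^'+, e < m / 4 by apply: nbhs_right_lt.
  have key y s e : `|curv G rho 1 z - curv G rho 1 y| <= m / 4 ->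
      `|curv G rho (- 1) z - curv G rho (- 1) y| <= m / 4 -> B y -> `|z - y| < r ->
      `|zeta - s| < r -> e < m / 4 -> bdry Omega y -> e <= margin (y, s).
    move=> c1 c2 By zy zs em bdy.
    have [cly _] := bdry_open oO bdy.
    have Hd : `|H (z, zeta) - H (y, s)| < m / 4.
      apply: rP; first by split.
      by rewrite [ltLHS]prod_normE /= gt_max zy zs.
    have [Em Ep] := curvE rhoD Bz bdz; have [Em' Ep'] := curvE rhoD By bdy.
    have : m <= m by []; rewrite {2}/m /margin /= !le_min Em Ep Em' Ep' => /andP[l1 l2].
    exact: margin_perturb l1 l2 c1 c2 Hd em.
  have f1 (Q : 'rV[R]_n -> Prop) : (\forall x \near z, Q x) ->
      \forall p \near (z, zeta), Q p.1.
    by move=> h; exact: (cvg_fst h).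
  have f2 (Q : R -> Prop) : (\forall x \near zeta, Q x) ->
      \forall p \near (z, zeta), Q p.2.
    by move=> h; exact: (cvg_snd h).
  have {}n1 := f1 _ n1; have {}n2 := f1 _ n2; have {}n3 := f1 _ n3.
  have {}n4 := f1 _ n4; have {}n5 := f2 _ n5.
  near=> p e => pA.
  have [bdp _] := pA.
  rewrite [X in margin X]surjective_pairing.
  have em : e < m / 4 by near: e.
  have q1 : `|curv G rho 1 z - curv G rho 1 p.1| <= m / 4 by near: p; exact: n1.
  have q2 : `|curv G rho (- 1) z - curv G rho (- 1) p.1| <= m / 4 by near: p; exact: n2.
  have q3 : B p.1 by near: p; exact: n3.
  have q4 : `|z - p.1| < r by near: p; exact: n4.
  have q5 : `|zeta - p.2| < r by near: p; exact: n5.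
  exact: key.
- move=> e0 /= e00 eP; apply: (@lt_le_trans _ _ (e0 / 2)); first by rewrite divr_gt0.
  apply: lb_le_inf.
    have h0 : `|0 : R| <= M by rewrite normr0 height_ge0.
    by exists (margin (x, 0)), x, 0.
  move=> _ [y [s [bdy sM ->]]].
  have := eP (e0 / 2); rewrite /ball_ /= sub0r normrN gtr0_norm ?divr_gt0 //.
  by move=> /(_ (half_lt e00) isT (y, s)); apply.
Unshelve. all: by end_near. Qed.

End fixed_data.

(** * C^2 norms and extensions of boundary values *)

Lemma sup_norm_ge n (Omega : set 'rV[R]_n) (f : 'rV[R]_n -> R) x :
  bounded_set Omega -> C0_ext Omega f -> Omega x -> `|f x| <= sup_norm Omega f.
Proof.
move=> bO [g [cg gf]] Ox; apply: ub_le_sup; last by exists x.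
have [b [_ bP]] : bounded_set (g @` closure Omega).
  exact/compact_bounded/continuous_compact/closure_compact.
exists (b + 1) => _ [y Oy <-]; rewrite -gf //; apply: (bP (b + 1)); rewrite ?ltrDl //.
by exists y => //; exact: subset_closure.
Qed.

Lemma ler_sum_term n (F : 'I_n -> R) i : (forall k, 0 <= F k) -> F i <= \sum_k F k.
Proof. by move=> F0; rewrite (bigD1 i) //= lerDl sumr_ge0. Qed.

Lemma C2_norm_ge n (Omega : set 'rV[R]_n) (f : 'rV[R]_n -> R) x i j :
  bounded_set Omega -> C2_closure Omega f -> Omega x ->
  [/\ `|f x| <= C2_norm Omega f, `|pd i f x| <= C2_norm Omega f
    & `|pd j (pd i f) x| <= C2_norm Omega f].
Proof.
move=> bO [fC cf f1 f2] Ox.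
have f0 : C0_ext Omega f by exists f.
have s0 := sup_norm_ge bO f0 Ox.
have s1 k := sup_norm_ge bO (f1 k) Ox.
have s2 k l := sup_norm_ge bO (f2 k l) Ox.
have p0 := le_trans (normr_ge0 _) s0.
have p1 k := le_trans (normr_ge0 _) (s1 k).
have p2 k l := le_trans (normr_ge0 _) (s2 k l).
have q1 := ler_sum_term i p1.
have q1' := le_trans (p1 i) q1.
have q2 := le_trans (ler_sum_term j (p2 i))
  (ler_sum_term i (fun k => sumr_ge0 _ (fun l _ => p2 k l))).
have q2' := le_trans (p2 i j) q2.
rewrite /C2_norm; split.
- by rewrite -addrA; apply: le_trans s0 _; rewrite lerDl addr_ge0.
- by rewrite addrAC; apply: le_trans (s1 i) _; apply: le_trans q1 _; rewrite lerDr addr_ge0.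
- by apply: le_trans (s2 i j) _; apply: le_trans q2 _; rewrite lerDr addr_ge0.
Qed.

(** The infimum that defines the boundary norm need not be attained, whence the [+ 1]. *)
Lemma exists_C2_extension n (Omega : set 'rV[R]_n) phi (i : 'I_n) : bounded_set Omega ->
  Omega !=set0 -> C2_bdry Omega phi ->
  exists2 Phi, C2_extension Omega phi Phi & C2_norm Omega Phi < C2_norm_bdry Omega phi + 1.
Proof.
move=> bO [x Ox] [Phi0 Phi0E].
have [|_ [Phi PhiE <-] h] := @inf_adherent R
    [set C2_norm Omega Phi | Phi in C2_extension Omega phi] 1 ltr01.
  split; first by exists (C2_norm Omega Phi0), Phi0.
  exists 0 => _ [Phi [PhiC _] <-].
  have [h _ _] := C2_norm_ge i i bO PhiC Ox.
  exact: le_trans (normr_ge0 _) h.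
by exists Phi.
Qed.

End data.

(** * The uniform bound *)

Section main.
Variable R : realType.

(** The argument [(L *: p, 1)] of [G] is [L] times [(p, L^-1)], so the vertical component tends to
    0, and every contribution of [Phi] and of the quadratic term carries a factor [L^-1]. *)
Lemma barrier_rescale n (G : 'rV[R]_(n + 1) -> 'M[R]_(n + 1)) (sg L k : R)
    (gP gr q : 'rV[R]_n) (HP Hr : 'M[R]_n) :
  weight_matrix G -> sg * sg = 1 -> 0 < L ->
  sg * \tr (wblock G (- (gP + sg *: (L *: gr + k *: q))) 1 *m
            (HP + sg *: (L *: Hr + k%:M))) =
  \tr (wblock G (- (sg *: gr) - L^-1 *: (gP + sg *: (k *: q))) L^-1 *m
       (Hr + L^-1 *: (sg *: HP + k%:M))).
Proof.
move=> wG sg2 L0; have Ln0 : L != 0 by rewrite gt_eqF.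
set p := - (sg *: gr) - L^-1 *: (gP + sg *: (k *: q)).
have -> : - (gP + sg *: (L *: gr + k *: q)) = L *: p.
  by apply/rowP => j; rewrite !mxE; field.
have -> : HP + sg *: (L *: Hr + k%:M) = (sg * L) *: (Hr + L^-1 *: (sg *: HP + k%:M)).
  apply/matrixP => i j; rewrite !mxE; move: (k *+ _) (HP i j) (Hr i j) => a b c.
  transitivity (sg * sg * b + sg * L * c + sg * a); first by rewrite sg2; ring.
  by field.
have -> : wblock G (L *: p) 1 = L^-1 *: wblock G p L^-1.
  rewrite /wblock; have -> : row_mx (L *: p) (1 : R)%:M = L *: row_mx p (L^-1)%:M.
    by rewrite scale_row_mx -[L *: _%:M]/(L *: _) scale_scalar_mx mulfV.
  rewrite weight_scale //; last by apply: row_mx_neq0r; rewrite invr_eq0.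
  by apply/matrixP => i j; rewrite !mxE.
rewrite -scalemxAl -scalemxAr !mxtraceZ !mulrA.
by rewrite -[sg * L^-1 * sg]mulrA [L^-1 * sg]mulrC mulrA sg2 mul1r mulVf // mul1r.
Qed.

Lemma norm_scalar_mx n (k : R) : 0 <= k -> `|k%:M : 'M[R]_n| <= k.
Proof.
move=> k0; apply: mx_norm_le => // i j; rewrite mxE.
by case: (i == j); rewrite ?mulr1n ?mulr0n ?normr0 // ger0_norm.
Qed.

(** The condition on [d * L] makes [L^-1 * (K + k * (r + 1))] less than [d / 2]. The factor [r + 1]
    covers both the gradient of the quadratic term, of size [k * r], and its Hessian, of size
    [k]. *)
Lemma rescaled_close n (sg L k K r d : R) (gz gx gP q : 'rV[R]_n) (Hz Hx HP : 'M[R]_n) :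
  `|sg| = 1 -> 0 < d -> 0 < L -> 0 <= k -> 0 <= r -> 0 <= K ->
  2 * (K + k * (r + 1)) < d * L ->
  `|gP| <= K -> `|q| <= r -> `|HP| <= K ->
  `|gz - gx| < d / 2 -> `|Hz - Hx| < d / 2 ->
  `|- (sg *: gz) - (- (sg *: gx) - L^-1 *: (gP + sg *: (k *: q)))| < d /\
  `|Hz - (Hx + L^-1 *: (sg *: HP + k%:M))| < d.
Proof.
move=> sg1 d0 L0 k0 r0 K0 dL gPK qr HPK gd Hd.
have iL0 : 0 < L^-1 by rewrite invr_gt0.
have small c : c <= K + k * (r + 1) -> L^-1 * c < d / 2.
  move=> cK; rewrite mulrC ltr_pdivrMr //.
  by rewrite mulrAC ltr_pdivlMr //; apply: le_lt_trans dL; rewrite mulrC ler_wpM2l.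
split.
- have -> : - (sg *: gz) - (- (sg *: gx) - L^-1 *: (gP + sg *: (k *: q))) =
      - (sg *: (gz - gx)) + L^-1 *: (gP + sg *: (k *: q)).
    by apply/rowP => j; rewrite !mxE; ring.
  apply: le_lt_trans (ler_normD _ _) _; rewrite [ltRHS]splitr.
  apply: ltrD; first by rewrite normrN normrZ sg1 mul1r.
  rewrite normrZ gtr0_norm //; apply: small.
  apply: le_trans (ler_normD _ _) _; rewrite !normrZ sg1 mul1r ger0_norm //.
  by apply: lerD => //; rewrite ler_wpM2l // ler_wpDr.
- have -> : Hz - (Hx + L^-1 *: (sg *: HP + k%:M)) =
      (Hz - Hx) - L^-1 *: (sg *: HP + k%:M) by rewrite opprD addrA.
  apply: le_lt_trans (ler_normB _ _) _; rewrite [ltRHS]splitr.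
  apply: ltrD => //; rewrite normrZ gtr0_norm //; apply: small.
  apply: le_trans (ler_normD _ _) _; rewrite normrZ sg1 mul1r.
  apply: lerD => //; apply: le_trans (norm_scalar_mx _ k0) _.
  by rewrite ler_peMr // lerDr.
Qed.

(** All constants are chosen at [z], before [x0] and before [G], [H], [phi], [u]; hence one bound
    serves a neighborhood of [z] and the whole class of data. *)
Lemma local_gradient_bound n (Omega : set 'rV[R]_n) z (K M gap : R) (omG omH : R -> R) :
  bounded_set Omega -> C2_domain Omega -> bdry Omega z -> 0 < gap -> 0 <= M ->
  (forall e, 0 < e -> exists2 d, 0 < d & omG d <= e) ->
  (forall e, 0 < e -> exists2 d, 0 < d & omH d <= e) ->
  \forall x0 \near z & C \near +oo, bdry Omega x0 ->
    forall G H phi u, admissible Omega G H phi u M -> C2_norm_bdry Omega phi = K ->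
      modulus_weight G = omG -> modulus_rhs Omega M H = omH ->
      curvature_gap G Omega M H = gap -> enorm (bgrad Omega u x0) <= C.
Proof.
move=> bO C2O bdz gap0 M0 omGs omHs.
have oO : open Omega by have [] := C2O.
have [k0 _] : exists k : 'I_n, True.
  by have [_ _ _ /(_ z bdz)[k _]] := C2O; exists k.
have [B [rho [Bz rhoD]]] := C2_domain_defining_function C2O bdz.
have [oB rhoC /(_ z Bz) gz0 _ _] := rhoD.
have e0 : 0 < gap / 4 by rewrite divr_gt0.
have close (sg : R) : sg = 1 \/ sg = - 1 -> exists2 d, 0 < d &
   forall (G : 'rV[R]_(n + 1) -> 'M[R]_(n + 1)) p s D, weight_class omG G ->
    `|- (sg *: grad rho z) - p| < d -> `|s| < d -> `|hess rho z - D| < d ->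
    `|curv G rho sg z - \tr (wblock G p s *m D)| <= gap / 4.
  move=> sgE; exact: (mxtrace_equicontinuous (hess rho z) (sign_neq0 sgE gz0) e0 omGs).
have [d1 d10 d1P] := close 1 (or_introl erefl).
have [d2 d20 d2P] := close (- 1) (or_intror erefl).
pose d := Num.min d1 d2; have d0 : 0 < d by rewrite lt_min d10 d20.
have [d3 d30 omH3] := omHs _ e0.
have dh : 0 < d / 2 by rewrite divr_gt0.
have n1 := grad_cvg rhoD Bz dh.
have n2 : \forall x \near z, B x by exact: open_nbhs_nbhs.
have /nbhs_normP[r1 /= r10 r1P] : \forall x \near z,
    B x /\ (`|grad rho z - grad rho x| < d / 2 /\ `|hess rho z - hess rho x| < d / 2).
  by near=> x; split; near: x.
(* The half lets the ball of radius [r] around any [x0] within [r] of [z] stay where [rho] is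
   controlled and where [omH] bounds the variation of [H]. *)
pose r := Num.min r1 d3 / 2.
have r0 : 0 < r by rewrite divr_gt0 // lt_min r10 d30.
have rr1 : r + r <= r1 by rewrite -splitr ge_min lexx.
have rd3 : r + r <= d3 by rewrite -splitr ge_min lexx orbT.
pose K2 := `|K| + 1; have K20 : 0 <= K2 by rewrite addr_ge0.
pose kappa := (M + K2) / r ^+ 2.
have kappa0 : 0 <= kappa by rewrite divr_ge0 ?addr_ge0 // sqr_ge0.
have kr : kappa * r ^+ 2 = M + K2 by rewrite divfK // expf_neq0 // gt_eqF.
have kk0 : 0 <= 2 * kappa by rewrite mulr_ge0.
pose c1 := K2 + 2 * kappa * (r + 1).
have c10 : 0 <= c1 by rewrite addr_ge0 // mulr_ge0 // addr_ge0 // ltW.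
(* This gives both [2 * c1 < d * L], as [rescaled_close] requires, and [L^-1 < d] for the vertical
   component. *)
pose L := (2 * c1 + 1) / d + 1.
have L0 : 0 < L by rewrite ltr_wpDl // divr_ge0 ?(ltW d0) // addr_ge0 // mulr_ge0.
have dL : d * L = 2 * c1 + 1 + d by rewrite mulrDr mulr1 mulrC divfK // gt_eqF.
have Ld : `|L^-1| < d.
  rewrite gtr0_norm ?invr_gt0 // -[L^-1]mul1r ltr_pdivrMr // dL.
  by move: (c1) c10 (d) d0 => ? ? ? ?; lra.
pose b := L * (3 * (`|grad rho z| + d) + 2) + K2.
have near_z : \forall x \near z, `|z - x| < r by apply/nbhs_normP; exists r.
near=> x0 C.
have Cb : Num.sqrt (n%:R * b ^+ 2) <= C by near: C; exact: nbhs_pinfty_ge.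
move=> bdx G H phi u adm phiK GE HE gapE.
have zx0 : `|z - x0| < r by near: x0.
have [[wG cG cH uC eqn] [phiC uphi uM _ _]] := adm.
have wc : weight_class omG G by split.
have [x1 Ox1] : Omega !=set0 by have [] := C2O.
have [Phi [PhiC Phiphi] PhiN] := exists_C2_extension k0 bO (ex_intro _ x1 Ox1) phiC.
have PhiN2 : C2_norm Omega Phi <= K2.
  by apply: ltW; apply: (lt_le_trans PhiN); rewrite phiK lerD2r ler_norm.
have Phi0 x : Omega x -> `|Phi x| <= K2.
  by move=> Ox; have [h _ _] := C2_norm_ge k0 k0 bO PhiC Ox; exact: le_trans h PhiN2.
have Phi1 x : Omega x -> `|grad Phi x| <= K2.
  move=> Ox; apply: mx_norm_le => // i j; rewrite mxE.
  by have [_ h _] := C2_norm_ge j k0 bO PhiC Ox; exact: le_trans h PhiN2.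
have Phi2 x : Omega x -> `|hess Phi x| <= K2.
  move=> Ox; apply: mx_norm_le => // i j; rewrite mxE.
  by have [_ _ h] := C2_norm_ge i j bO PhiC Ox; exact: le_trans h PhiN2.
have uPhi x : bdry Omega x -> u x = Phi x by move=> bx; rewrite uphi // Phiphi.
have [uC2 cu _ _] := uC; have [PhiC2 cPhi _ _] := PhiC.
have zball x : `|x0 - x| <= r -> `|z - x| < r + r.
  move=> x0x; rewrite -(subrKA x0) (le_lt_trans (ler_normD _ _)) //.
  exact: ltr_leD.
have ballB x : `|x0 - x| <= r -> B x.
  by move=> /zball zx; have [] := r1P x (lt_le_trans zx rr1).
have Bx0 : B x0 by apply: ballB; rewrite subrr normr0 ltW.
have [clz _] := bdry_open oO bdz.
have comparison (sg : R) : sg = 1 \/ sg = - 1 ->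
    forall x, Omega x -> `|x0 - x| < r ->
    sg * (u x - Phi x) <= L * rho x + kappa * dot (x - x0) (x - x0).
  move=> sgE; have sg1 := sign_norm sgE.
  have sg2 : sg * sg = 1 by case: sgE => ->; rewrite ?mulrNN mulr1.
  apply: (@barrier_comparison R n Omega B rho G u Phi (fun x => H (x, u x))
    x0 r L kappa M K2) => //.
  - exact: ltW.
  - by rewrite kr.
  - by move=> x Ox; exact: (prescribed_wmc_graphE wG oO uC2 eqn Ox).
  move=> x Ox x0x.
  have zx := zball x (ltW x0x).
  have [_ [g1 h1]] := r1P x (lt_le_trans zx rr1).
  rewrite barrier_rescale //.
  have qr : `|x - x0| <= r by rewrite distrC ltW.
  have dLc : 2 * (K2 + 2 * kappa * (r + 1)) < d * L.
    by rewrite -/c1 dL; move: (c1) (d) d0 => ? ? ?; lra.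
  have [pd1 pd2] := rescaled_close sg1 d0 L0 kk0 (ltW r0) K20 dLc (Phi1 x Ox) qr (Phi2 x Ox) g1 h1.
  have dd1 : d <= d1 by rewrite ge_min lexx.
  have dd2 : d <= d2 by rewrite ge_min lexx orbT.
  set p := - (sg *: grad rho x) - _ in pd1 *; set D := hess rho x + _ in pd2 *.
  have trE : `|curv G rho sg z - \tr (wblock G p L^-1 *m D)| <= gap / 4.
    case: sgE pd1 => sgE pd1.
      rewrite sgE; apply: (d1P G p L^-1 D wc);
        [|exact: lt_le_trans Ld dd1|exact: lt_le_trans pd2 dd1].
      by rewrite -sgE; exact: lt_le_trans pd1 dd1.
    rewrite sgE; apply: (d2P G p L^-1 D wc);
      [|exact: lt_le_trans Ld dd2|exact: lt_le_trans pd2 dd2].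
    by rewrite -sgE; exact: lt_le_trans pd1 dd2.
  (* The gap is available at boundary points only, so it is used at [z] with the height [u x].
     Passing from [z] to [x] costs [gap / 4] in the operator and [gap / 4] in [H], which leaves
     strict inequality. *)
  have gapz := curvature_gap_curv C2O adm rhoD Bz bdz (uM x Ox) sgE.
  have zx3 : `|z - x| <= d3 by apply: ltW; exact: lt_le_trans zx rd3.
  have Hzx := modulus_rhs_ge bO adm clz (subset_closure Ox) (uM x Ox) zx3.
  rewrite HE in Hzx; rewrite gapE in gapz.
  have Hzx2 : `|sg * H (z, u x) - sg * H (x, u x)| <= gap / 4.
    by rewrite -mulrBr normrM sg1 mul1r; exact: le_trans Hzx omH3.
  move: (\tr _) (curv _ _ _ _) (sg * H (z, u x)) (sg * H (x, u x)) trE gapz Hzx2.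
  move=> t1 t2 t3 t4; rewrite !ler_distl => /andP[? ?] ? /andP[? ?].
  by move: (gap) gap0 => *; lra.
have bar x : Omega x -> `|x0 - x| < r ->
    `|u x - Phi x| <= L * rho x + kappa * dot (x - x0) (x - x0).
  move=> Ox x0x; rewrite ler_norml lerNl -mulN1r -[X in _ && (X <= _)]mul1r.
  by rewrite !comparison //; [left|right].
have gx0 : `|grad rho x0| <= `|grad rho z| + d.
  have x00 : `|x0 - x0| <= r by rewrite subrr normr0 ltW.
  have [_ [g1 _]] := r1P x0 (lt_le_trans (zball x0 x00) rr1).
  have -> : grad rho x0 = grad rho z - (grad rho z - grad rho x0) by rewrite opprB addrC subrK.
  apply: le_trans (ler_normB _ _) _; rewrite lerD2l.
  exact: ltW (lt_trans g1 (half_lt d0)).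
have coord k : `|bgrad Omega u x0 0 k| <= b.
  have Phi1k y : Omega y -> `|pd k Phi y| <= K2.
    by move=> Oy; have [_ h _] := C2_norm_ge k k0 bO PhiC Oy; exact: le_trans h PhiN2.
  apply: le_trans (bgrad_bound oO rhoD Bx0 bdx uC PhiC uPhi r0 (ltW L0) kappa0 bar Phi1k) _.
  by rewrite /b lerD2r ler_wpM2l ?(ltW L0) // lerD2r ler_wpM2l.
exact: le_trans (enorm_le_coord coord) Cb.
Unshelve. all: by end_near. Qed.

Lemma gradient_bound n (Omega : set 'rV[R]_n) (K M gap : R) (omG omH : R -> R) :
  bounded_set Omega -> C2_domain Omega ->
  exists C, forall G H phi u, admissible Omega G H phi u M ->
    C2_norm_bdry Omega phi = K -> modulus_weight G = omG ->
    modulus_rhs Omega M H = omH -> curvature_gap G Omega M H = gap ->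
    forall x, bdry Omega x -> enorm (bgrad Omega u x) <= C.
Proof.
move=> bO C2O; have oO : open Omega by have [] := C2O.
(* The parameters are arbitrary here. Small moduli and a positive gap are known only if some
   admissible data realize them; otherwise any constant will do. *)
have [[G0 [H0 [phi0 [u0 [adm0 GE0 HE0 gapE0]]]]]|none] := pselect (exists G H phi u,
    [/\ admissible Omega G H phi u M, modulus_weight G = omG,
     modulus_rhs Omega M H = omH & curvature_gap G Omega M H = gap]); last first.
  by exists 0 => G H phi u adm _ GE HE gapE; exfalso; apply: none; exists G, H, phi, u.
have M0 := height_ge0 C2O adm0.
have omGs e : 0 < e -> exists2 d, 0 < d & omG d <= e.
  by rewrite -GE0; exact: (modulus_weight_small adm0).
have omHs e : 0 < e -> exists2 d, 0 < d & omH d <= e.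
  by rewrite -HE0; exact: (modulus_rhs_small bO adm0).
have /near_covering_withinP cov := (compact_near_coveringP _).1 (bdry_compact oO bO).
pose P C x := forall G H phi u, admissible Omega G H phi u M ->
  C2_norm_bdry Omega phi = K -> modulus_weight G = omG ->
  modulus_rhs Omega M H = omH -> curvature_gap G Omega M H = gap ->
  enorm (bgrad Omega u x) <= C.
have /filter_ex[C CP] : \forall C \near +oo, bdry Omega `<=` P C.
  apply: (cov R +oo P) => z bdz; apply: local_gradient_bound => //.
  by rewrite -gapE0; exact: (curvature_gap_gt0 bO C2O adm0 bdz).
by exists C => G H phi u adm e1 e2 e3 e4 x bdx; exact: (CP x bdx G H phi u).
Qed.

End main.

Theorem theorem4 (R : realType) (n : nat) (Omega : set 'rV[R]_n)
    (Omega_bounded : bounded_set Omega) (Omega_C2 : C2_domain Omega) :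
  exists C : R -> R -> (R -> R) -> (R -> R) -> R -> R,
  forall (G : 'rV[R]_(n + 1) -> 'M[R]_(n + 1)) (H : 'rV[R]_n * R -> R)
    (phi u : 'rV[R]_n -> R) (M : R),
    weight_matrix G ->
    (forall p, p != 0 -> {for p, continuous G}) ->
    {within closure Omega `*` [set: R], continuous H} ->
    C2_closure Omega u ->
    prescribed_wmc_graph G Omega H u ->
    C2_bdry Omega phi ->
    (forall x, bdry Omega x -> u x = phi x) ->
    (forall x, Omega x -> `|u x| <= M) ->
    (forall x, bdry Omega x -> 0 < H_plus G Omega x /\ H_minus G Omega x < 0) ->
    (forall x z, bdry Omega x -> `|z| <= M ->
       H_minus G Omega x < H (x, z) < H_plus G Omega x) ->
    forall x, bdry Omega x ->
      enorm (bgrad Omega u x) <=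
        C (C2_norm_bdry Omega phi) M (modulus_weight G)
          (modulus_rhs Omega M H) (curvature_gap G Omega M H).
Proof.
(* The constant is selected for each value of the five parameters before any data are given, so it
   is a function of them alone. *)
exists (fun K M omG omH gap =>
  sval (cid (gradient_bound K M gap omG omH Omega_bounded Omega_C2))).
move=> G H phi u M h1 h2 h3 h4 h5 h6 h7 h8 h9 h10 x bdx.
case: cid => C CP /=; exact: (CP G H phi u).
Qed.
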